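(* Let $\mathfrak g$ be a reductive real Lie algebra, $h\in\mathfrak g$ an Euler element and $\theta$ a Cartan involution of $\mathfrak g$ with $\theta(h)=-h$ and $\mathfrak z(\mathfrak g)\subseteq\mathfrak g^{-\theta}$. Then: (a) $\tau:=\tau_h\theta$ is an involution of $\mathfrak g$; (b) the symmetric Lie algebra $(\mathfrak g,\tau)$ is non-compactly causal and there exists a pointed generating $\mathrm{Inn}_{\mathfrak g}(\mathfrak h)$-invariant closed convex cone $C\subseteq\mathfrak q$ with $h\in C^\circ$; (c) all ideals of $\mathfrak g$ contained in $\mathfrak g^\tau$ are compact.
   Context: Euler element: $\mathrm{ad}\,h\ne0$ diagonalizable with spectrum in $\{-1,0,1\}$; $\tau_h=e^{\pi i\,\mathrm{ad}\,h}$ acts by $(-1)^j$ on the $j$-eigenspace of $\mathrm{ad}\,h$. $\mathfrak h=\mathfrak g^\tau$, $\mathfrak q=\mathfrak g^{-\tau}$; $\mathrm{Inn}_{\mathfrak g}(\mathfrak h)$ is the group generated by $e^{\mathrm{ad}\,x}$, $x\in\mathfrak h$. $(\mathfrak g,\tau)$ is non-compactly causal if there exists a pointed generating closed convex $\mathrm{Inn}_{\mathfrak g}(\mathfrak h)$-invariant cone $C\subseteq\mathfrak q$ such that $\mathrm{ad}\,x$ is diagonalizable for every $x\in C^\circ$. *)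

(* Defs.v *)
(* A finite-dimensional real Lie algebra
   is modelled as R^n (row vectors 'rV[R]_n) with a bracket [br]. Linear maps
   act on the right: x |-> x *m M. *)
From HB Require Import structures.
From mathcomp Require Import all_boot all_order all_algebra.
From mathcomp Require Import all_classical all_reals all_analysis.
Set Implicit Arguments. Unset Strict Implicit. Unset Printing Implicit Defensive.
Import Order.TTheory GRing.Theory Num.Theory.
Import numFieldNormedType.Exports.
Local Open Scope ring_scope.
Local Open Scope classical_set_scope.

Section LieDefs.
Variables (R : realType) (n : nat).
Notation V := 'rV[R]_n.
Variable br : V -> V -> V.

Definition is_lie_bracket : Prop :=
  [/\ (forall a x y z, br (a *: x + y) z = a *: br x z + br y z),
      (forall a x y z, br x (a *: y + z) = a *: br x y + br x z),
      (forall x, br x x = 0) &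
      (forall x y z, br x (br y z) + br y (br z x) + br z (br x y) = 0)].

Definition ad (x : V) : 'M[R]_n := lin1_mx (br x).

Definition killing (x y : V) : R := \tr (ad x *m ad y).

Definition diag_with (A : 'M[R]_n) (S : R -> Prop) : Prop :=
  exists (P : 'M[R]_n) (d : 'rV[R]_n),
    [/\ P \in unitmx, P *m A = diag_mx d *m P & forall i, S (d 0 i)].

Definition diagonalizable_R (A : 'M[R]_n) : Prop := diag_with A (fun _ => True).

Definition euler (h : V) : Prop :=
  ad h != 0 /\ diag_with (ad h) (fun a => a = -1 \/ a = 0 \/ a = 1).

(* tau_h = e^{pi i ad h}: acts by (-1)^j on the j-eigenspace of ad h *)
Definition is_tau_h (h : V) (T : 'M[R]_n) : Prop :=
  [/\ (forall v : V, v *m ad h = v -> v *m T = - v),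
      (forall v : V, v *m ad h = 0 -> v *m T = v) &
      (forall v : V, v *m ad h = - v -> v *m T = - v)].

Definition lie_aut (M : 'M[R]_n) : Prop :=
  M \in unitmx /\ forall x y : V, br (x *m M) (y *m M) = br x y *m M.

Definition lie_involution (M : 'M[R]_n) : Prop := lie_aut M /\ M *m M = 1%:M.

Definition in_derived (x : V) : Prop :=
  exists c : 'M[R]_n,
    x = \sum_(i < n) \sum_(j < n) c i j *: br (delta_mx 0 i) (delta_mx 0 j).

Definition in_center (x : V) : Prop := forall y, br x y = 0.

Definition is_ideal (I : 'M[R]_n) : Prop :=
  forall x v : V, (v <= I)%MS -> (br x v <= I)%MS.

(* reductive: the adjoint representation is semisimple, i.e. every ideal
   has a complementary ideal *)
Definition reductive : Prop :=
  forall I, is_ideal I ->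
    exists J, [/\ is_ideal J, (I :&: J)%MS == 0 :> 'M[R]_n & (I + J == 1%:M)%MS].

(* Cartan involution of a reductive Lie algebra: an involutive automorphism
   whose restriction to the semisimple algebra [g,g] is a Cartan involution,
   i.e. -kappa(x, theta x) > 0 for 0 <> x in [g,g]; here the Killing form of
   g restricted to [g,g] (= Killing form of [g,g]) is used. *)
Definition cartan_involution (Th : 'M[R]_n) : Prop :=
  lie_involution Th /\
  forall x : V, in_derived x -> x != 0 -> 0 < - killing x (x *m Th).

Definition expmx (A : 'M[R]_n) : 'M[R]_n :=
  lim ((fun N : nat => \sum_(k < N) (k`!%:R)^-1 *: A ^+ k) @ \oo).

Definition fixed (M : 'M[R]_n) : set V := [set x | x *m M = x].
Definition antifixed (M : 'M[R]_n) : set V := [set x | x *m M = - x].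

(* Inn_g(h): the subgroup of GL(g) generated by e^{ad x}, x in h
   (inverses e^{-ad x} = e^{ad(-x)} are among the generators) *)
Inductive inn_group (hh : set V) : 'M[R]_n -> Prop :=
| inn_one : inn_group hh 1%:M
| inn_mul x g : hh x -> inn_group hh g -> inn_group hh (expmx (ad x) *m g).

Definition good_cone (hh q : set V) (C : set V) : Prop :=
  [/\ C `<=` q, C 0,
      (forall x y, C x -> C y -> C (x + y)),
      (forall (a : R) x, 0 <= a -> C x -> C (a *: x)) &
      closed C] /\
  [/\ (forall x, C x -> C (- x) -> x = 0),
      (forall z, q z -> exists x y, [/\ C x, C y & z = x - y]) &
      (forall g x, inn_group hh g -> C x -> C (x *m g))].

Definition rel_interior (q C : set V) : set V :=
  [set x | C x /\ \forall y \near x, q y -> C y].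

Definition ncc (Tau : 'M[R]_n) : Prop :=
  exists C, good_cone (fixed Tau) (antifixed Tau) C /\
    forall x, rel_interior (antifixed Tau) C x -> diagonalizable_R (ad x).

Definition compact_ideal (I : 'M[R]_n) : Prop :=
  exists S : 'M[R]_n,
    [/\ (forall u v : V, (u <= I)%MS -> (v <= I)%MS ->
           (u *m S *m v^T) 0 0 = (v *m S *m u^T) 0 0),
        (forall u : V, (u <= I)%MS -> u != 0 -> 0 < (u *m S *m u^T) 0 0) &
        (forall x y z : V, (x <= I)%MS -> (y <= I)%MS -> (z <= I)%MS ->
           (br x y *m S *m z^T) 0 0 = - (y *m S *m (br x z)^T) 0 0)].

End LieDefs.

(* Main.v *)
Require Import Defs.
From HB Require Import structures.
From mathcomp Require Import all_boot all_order all_algebra.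
From mathcomp Require Import all_classical all_reals all_analysis.
From mathcomp Require Import ring lra.
Import Order.TTheory GRing.Theory Num.Theory.
Import numFieldNormedType.Exports.
Local Open Scope ring_scope.
Local Open Scope classical_set_scope.
Set Implicit Arguments.
Unset Strict Implicit.
Unset Printing Implicit Defensive.

(* Let N = ad h, let kappa be the Killing form, and let <u, v> be -kappa(u, theta v) corrected
   on the center to an inner product. For y in q put M(y) = N^2 (ad y) N, a symmetric operator
   with trace kappa(h, y). For g in Inn(h) the form <u, tau_h v> is g-invariant, which gives
   |M(gh) u| >= |u| for u in the odd part of the grading; as M(h) = N^2 >= 0, connectedness of
   Inn(h) keeps M(gh) positive semidefinite, so kappa(h, gh) = tr M(gh) >= 1 and the norm of
   g is at most a constant times kappa(h, gh). Hence for small d > 0 the cone of the x in q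
   with kappa(h, gx) >= d |gx| for all g has h in its interior. For x in the interior,
   g |-> kappa(h, gx) is proper and attains its minimum on a closed set of g that
   contains Inn(h) and is stable under it; there z = gx is critical, which forces [h, z] = 0,
   hence theta z = -z, so that ad z is symmetric and ad x is diagonalizable. *)

(** The obstacle is uniformity in g over a group that may be noncompact and is not known to be
    closed. The number kappa(h, gh) is meant to control the size of g, but a trace bounds a
    symmetric operator only when the operator is positive; otherwise eigenvalues of opposite sign
    cancel. Positivity of M(gh) is therefore the heart of the argument. It survives along paths
    because the eigenvalues of M(gh) on the odd part have absolute value at least 1, so none can
    cross 0. The resulting inequality |g| <= B kappa(h, gh) is used twice: it puts a ball of q
    around h inside the cone, and it makes the relevant sublevel sets compact, so that minima
    exist. *)

(** * Entrywise derivatives of matrix-valued functions *)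

Section MatrixDerivative.
Variable R : realType.

Definition mxder m p (F : R -> 'M[R]_(m, p)) (t : R) (D : 'M[R]_(m, p)) :=
  forall i j, is_derive t (1 : R) (fun s => F s i j) (D i j).

Lemma mxder_const m p (A : 'M[R]_(m, p)) t : mxder (fun=> A) t 0.
Proof. by move=> i j; rewrite mxE; exact: is_derive_cst. Qed.

Lemma mxderM m p q (F : R -> 'M[R]_(m, p)) (G : R -> 'M[R]_(p, q)) t D D' :
  mxder F t D -> mxder G t D' ->
  mxder (fun s => F s *m G s) t (D *m G t + F t *m D').
Proof.
move=> HF HG i j.
rewrite (_ : (fun s => _) = \sum_(k < p) (fun s => F s i k * G s k j)); last first.
  by apply/funext => s; rewrite mxE fct_sumE.
have -> : (D *m G t + F t *m D') i j =
    \sum_(k < p) (F t i k *: D' k j + G t k j *: D i k).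
  rewrite !mxE -big_split; apply: eq_bigr => k _ /=.
  by rewrite addrC; congr (_ + _); rewrite mulrC.
apply: is_derive_sum => k; exact: is_deriveM.
Qed.

Lemma mxder_tr m p (F : R -> 'M[R]_(m, p)) t D :
  mxder F t D -> mxder (fun s => (F s)^T) t D^T.
Proof.
move=> HF i j; rewrite mxE (_ : (fun s => _) = (fun s => F s j i)) //.
by apply/funext => s; rewrite mxE.
Qed.

Lemma mxder0_const m p (F : R -> 'M[R]_(m, p)) s t :
  (forall u, mxder F u 0) -> F s = F t.
Proof.
move=> HF; apply/matrixP => i j.
apply: (@is_derive_0_is_cst R (fun u => F u i j)) => u.
by have := HF u i j; rewrite mxE.
Qed.

End MatrixDerivative.

(** * Convergence and continuity of matrix-valued maps *)

Lemma cvg_mx (R : realType) (T : Type) (G : set_system T) m p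
    (F : T -> 'M[R]_(m, p)) (L : 'M[R]_(m, p)) : Filter G ->
  (forall i j, F x i j @[x --> G] --> L i j) -> F @ G --> L.
Proof.
move=> FG FL; apply/cvgrPdist_le => /= e e0; near=> x.
rewrite /Num.Def.normr/= mx_normrE (bigmax_le _ (ltW e0))//= => i _.
rewrite !mxE/=; move: i; near: x; apply: filter_forall => /= i.
exact: ((cvgrPdist_le _ _).1 (FL i.1 i.2)).
Unshelve. all: by end_near. Qed.

Section MatrixContinuity.
Variables (R : realType) (T : topologicalType).

Definition mxcts m p (F : T -> 'M[R]_(m, p)) :=
  forall i j, continuous (fun t => F t i j).

Lemma mxcts_const m p (A : 'M[R]_(m, p)) : mxcts (fun=> A).
Proof. by move=> i j; exact: cst_continuous. Qed.

Lemma mxctsD m p (F G : T -> 'M[R]_(m, p)) :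
  mxcts F -> mxcts G -> mxcts (fun t => F t + G t).
Proof.
move=> HF HG i j t; rewrite /continuous_at mxE; under eq_fun do rewrite mxE.
exact: cvgD (HF i j t) (HG i j t).
Qed.

Lemma mxctsM m p q (F : T -> 'M[R]_(m, p)) (G : T -> 'M[R]_(p, q)) :
  mxcts F -> mxcts G -> mxcts (fun t => F t *m G t).
Proof.
move=> HF HG i j t; rewrite /continuous_at mxE; under eq_fun do rewrite mxE.
apply: cvg_big => [|k _]; first exact: add_continuous.
exact: cvgM (HF i k t) (HG k j t).
Qed.

Lemma mxcts_tr m p (F : T -> 'M[R]_(m, p)) : mxcts F -> mxcts (fun t => (F t)^T).
Proof.
by move=> HF i j t; rewrite /continuous_at mxE; under eq_fun do rewrite mxE; exact: HF.
Qed.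

Lemma closed_mxeq m p (F G : T -> 'M[R]_(m, p)) :
  mxcts F -> mxcts G -> closed [set t | F t = G t].
Proof.
move=> HF HG; rewrite (_ : [set t | _] =
    \bigcap_(ij in [set: 'I_m * 'I_p]) [set t | F t ij.1 ij.2 - G t ij.1 ij.2 = 0]).
  apply: closed_bigI => -[i j] _ /=.
  apply: (@closed_comp _ _ (fun t => F t i j - G t i j) [set x | x = 0]).
    by move=> t _; exact: cvgB (HF i j t) (HG i j t).
  exact: closed_eq.
apply/seteqP; split=> t /=; first by move=> e [i j] _ /=; rewrite e subrr.
by move=> H; apply/matrixP => i j; apply/eqP; rewrite -subr_eq0 (H (i, j) I).
Qed.

Lemma closed_mxge0 (F : T -> 'M[R]_1) : mxcts F -> closed [set t | 0 <= F t 0 0].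
Proof.
move=> HF; apply: (@closed_comp _ _ (fun t => F t 0 0) [set x | 0 <= x]).
  by move=> t _; exact: HF.
exact: closed_ge.
Qed.

Lemma continuous_mx m p (F : T -> 'M[R]_(m, p)) : mxcts F -> continuous F.
Proof. by move=> HF t; apply: cvg_mx => i j; exact: HF. Qed.

End MatrixContinuity.

Lemma mxcts_id (R : realType) m p : mxcts (@idfun 'M[R]_(m, p)).
Proof. exact: coord_continuous. Qed.

Lemma mxder_mxcts (R : realType) m p (F D : R -> 'M[R]_(m, p)) :
  (forall t, mxder F t (D t)) -> mxcts F.
Proof.
move=> HF i j t.
apply/differentiable_continuous/derivable1_diffP.
by case: (HF t i j).
Qed.

(** * The matrix exponential and its derivative *)

Section MatrixExponential.
Variables (R : realType) (n : nat).
Implicit Types X : 'M[R]_n.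

(** The k-th Taylor coefficient in t of the (i, j) entry of X^d e^{tX}. The shift [d] makes the
    family stable under formal differentiation, which sends [d] to [d.+1]. *)
Let expc X (i j : 'I_n) (d k : nat) : R := (X ^+ (k + d)) i j / k`!%:R.

Let mass X : R := \sum_i \sum_j `|X i j|.

Let mass_ge0 X : 0 <= mass X.
Proof. by rewrite sumr_ge0 // => l _; rewrite sumr_ge0. Qed.

Lemma sum_norm_expmx_le X k i : \sum_j `|(X ^+ k) i j| <= mass X ^+ k.
Proof.
elim: k i => [|k IH] i.
  rewrite !expr0 (bigD1 i) //= big1 ?addr0 => [|j ji].
    by rewrite mxE eqxx normr1.
  by rewrite mxE eq_sym (negPf ji) normr0.
apply: (@le_trans _ _ (\sum_j \sum_l `|X i l| * `|(X ^+ k) l j|)).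
  apply: ler_sum => j _; rewrite exprS mxE.
  apply: le_trans (ler_norm_sum _ _ _) _.
  by apply: ler_sum => l _; rewrite normrM.
rewrite exchange_big /= exprS.
apply: (@le_trans _ _ (\sum_l `|X i l| * mass X ^+ k)).
  by apply: ler_sum => l _; rewrite -mulr_sumr ler_wpM2l.
rewrite -mulr_suml; apply: ler_wpM2r; first exact/exprn_ge0/mass_ge0.
rewrite /mass [leRHS](bigD1 i) //= lerDl.
by apply: sumr_ge0 => l _; exact: sumr_ge0.
Qed.

Lemma is_cvg_expc X i j d x : cvgn (pseries (expc X i j d) x).
Proof.
apply: normed_cvg.
apply: (@series_le_cvg _ _ (mass X ^+ d *: exp_coeff (mass X * `|x|))).
- by move=> k /=; exact: normr_ge0.
- by move=> k; rewrite /GRing.scale /= mulr_ge0 ?exprn_ge0 // exp_coeff_ge0 // mulr_ge0.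
- move=> k /=; rewrite /expc /exp_coeff /=.
  rewrite !normrM normfV (ger0_norm (ler0n _ _)) normrX.
  rewrite [leRHS](_ : _ = mass X ^+ (k + d) / k`!%:R * `|x| ^+ k); last first.
    rewrite exprD /GRing.scale /= exprMn -[LHS]/(_ * _); ring.
  rewrite ler_wpM2r ?exprn_ge0 // ler_wpM2r ?invr_ge0 //.
  apply: le_trans (sum_norm_expmx_le X (k + d) i).
  by rewrite (bigD1 j) //= lerDl sumr_ge0.
- by apply: is_cvg_seriesZ; exact: is_cvg_series_exp_coeff.
Qed.

Let expcE X i j d : pseries_diffs (expc X i j d) = expc X i j d.+1.
Proof.
apply/funext => k; rewrite /pseries_diffs /expc factS natrM addnS addSn.
rewrite invfM mulrCA; congr (_ * _).
by rewrite mulrA divff ?mul1r // pnatr_eq0.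
Qed.

Lemma exprmxZ X t k : (t *: X) ^+ k = t ^+ k *: X ^+ k.
Proof.
elim: k => [|k IH]; first by rewrite !expr0 scale1r.
rewrite !exprS IH; apply/matrixP => i j; rewrite !mxE big_distrr /=.
by apply: eq_bigr => l _; rewrite !mxE; ring.
Qed.

Lemma expmxE X t i j : expmx (t *: X) i j = limn (pseries (expc X i j 0) t).
Proof.
set L := (RHS).
pose M := \matrix_(i, j) limn (pseries (expc X i j 0) t).
suff -> : expmx (t *: X) = M by rewrite mxE.
apply: cvg_lim => //; apply: cvg_mx => {L} i' j'; rewrite mxE.
rewrite (_ : (fun k => _) = pseries (expc X i' j' 0) t).
  exact: is_cvg_expc.
apply/funext => N; rewrite /pseries /series /= summxE big_mkord.
apply: eq_bigr => k _; rewrite /expc addn0 exprmxZ !mxE; ring.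
Qed.

Lemma expmx0 X : expmx (0 *: X) = 1%:M.
Proof.
apply/matrixP => i j; rewrite expmxE.
apply: (@lim_near_cst R^o) => //; near=> N.
(* The partial sum for N = 0 is empty, so the value 1 appears only from N = 1 on. *)
have N0 : (0 < N)%N by near: N; exists 1%N.
rewrite -(prednK N0) /pseries /series /= big_nat_recl //= big1 ?addr0.
  by rewrite /expc addn0 !expr0 divr1 mulr1.
by move=> k _; rewrite exprS mul0r mulr0.
Unshelve. all: by end_near. Qed.

(** X commutes with its powers, so the partial sums of both sides agree. This allows the derivative
    of e^{tX} to be written with X on either side. *)
Lemma expmx_comm X t : X *m expmx (t *: X) = expmx (t *: X) *m X.
Proof.
have cvgL i j : (fun N => \sum_l X i l * pseries (expc X l j 0) t N) @ \oo -->
    (X *m expmx (t *: X)) i j.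
  rewrite mxE; apply: cvg_big => //; first exact: add_continuous.
  move=> l _; apply: cvgMl_tmp; rewrite expmxE; exact: is_cvg_expc.
have cvgR i j : (fun N => \sum_l pseries (expc X i l 0) t N * X l j) @ \oo -->
    (expmx (t *: X) *m X) i j.
  rewrite mxE; apply: cvg_big => //; first exact: add_continuous.
  move=> l _; apply: cvgMr_tmp; rewrite expmxE; exact: is_cvg_expc.
apply/matrixP => i j; apply: (cvg_unique _ (cvgL i j)) => //.
apply: cvg_trans (cvgR i j); apply: near_eq_cvg; near=> N.
rewrite /pseries /series /=.
under eq_bigr do rewrite mulr_suml.
under [RHS]eq_bigr do rewrite mulr_sumr.
rewrite exchange_big [RHS]exchange_big /=; apply: eq_bigr => k _.
transitivity ((X ^+ k *m X) i j / k`!%:R * t ^+ k).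
  by rewrite mxE !mulr_suml; apply: eq_bigr => l _; rewrite /expc addn0; ring.
have -> : X ^+ k *m X = X *m X ^+ k by rewrite -[LHS]exprSr -[RHS]exprS.
by rewrite mxE !mulr_suml; apply: eq_bigr => l _; rewrite /expc addn0; ring.
Unshelve. all: by end_near. Qed.

Lemma mxder_expmx X t : mxder (fun s => expmx (s *: X)) t (X *m expmx (t *: X)).
Proof.
move=> i j.
rewrite (_ : (fun s => _) = (fun s => limn (pseries (expc X i j 0) s))); last first.
  by apply/funext => s; rewrite expmxE.
suff -> : (X *m expmx (t *: X)) i j = limn (pseries (pseries_diffs (expc X i j 0)) t).
  apply: (@pseries_snd_diffs _ _ (`|t| + 1)); rewrite ?expcE; try exact: is_cvg_expc.
  by rewrite [ltRHS]ger0_norm ?ltrDl // addr_ge0.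
rewrite expcE; apply/esym; apply: cvg_lim => //.
rewrite mxE.
rewrite (_ : pseries _ _ = (fun N => \sum_l X i l * pseries (expc X l j 0) t N)).
  apply: cvg_big => //; first exact: add_continuous.
  move=> l _; apply: cvgMl_tmp; rewrite expmxE; exact: is_cvg_expc.
apply/funext => N; rewrite /pseries /series /=.
under [RHS]eq_bigr do rewrite mulr_sumr.
rewrite exchange_big /=; apply: eq_bigr => k _.
rewrite /expc addn1 addn0 exprS mxE mulr_suml mulr_suml.
by apply: eq_bigr => l _; ring.
Qed.
End MatrixExponential.

(** * The spectral theorem and positive operators for a general inner product *)

Section InnerProduct.
Variables (R : realType) (n : nat) (K : 'M[R]_n).
Implicit Types (u v w : 'rV[R]_n) (A : 'M[R]_n).

Definition inner u v : R := (u *m K *m v^T) 0 0.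

Lemma gram_entry i j : K i j = inner (delta_mx 0 i) (delta_mx 0 j).
Proof. by rewrite /inner trmx_delta -rowE -colE !mxE. Qed.

Lemma ipDl u v w : inner (u + v) w = inner u w + inner v w.
Proof. by rewrite /inner !mulmxDl mxE. Qed.
Lemma ipDr u v w : inner w (u + v) = inner w u + inner w v.
Proof. by rewrite /inner linearD mulmxDr mxE. Qed.
Lemma ipZl a u w : inner (a *: u) w = a * inner u w.
Proof. by rewrite /inner -!scalemxAl mxE. Qed.
Lemma ipZr a u w : inner w (a *: u) = a * inner w u.
Proof. by rewrite /inner linearZ -scalemxAr mxE. Qed.
Lemma ipNl u w : inner (- u) w = - inner u w.
Proof. by rewrite -scaleN1r ipZl mulN1r. Qed.
Lemma ipNr u w : inner w (- u) = - inner w u.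
Proof. by rewrite -scaleN1r ipZr mulN1r. Qed.
Lemma ip0l u : inner 0 u = 0.
Proof. by rewrite /inner !mul0mx mxE. Qed.
Lemma ip0r u : inner u 0 = 0.
Proof. by rewrite /inner trmx0 mulmx0 mxE. Qed.

Lemma ip_mxcts (T : topologicalType) (F G : T -> 'rV[R]_n) :
  mxcts F -> mxcts G -> mxcts (fun t => F t *m K *m (G t)^T).
Proof.
move=> HF HG; apply: mxctsM; last exact: mxcts_tr.
by apply: mxctsM => //; exact: mxcts_const.
Qed.

Lemma ip_continuous (T : topologicalType) (F G : T -> 'rV[R]_n) :
  mxcts F -> mxcts G -> continuous (fun t => inner (F t) (G t)).
Proof. by move=> HF HG; exact: (ip_mxcts HF HG). Qed.

Hypothesis Ksym : K^T = K.

Lemma ipC u v : inner u v = inner v u.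
Proof.
by rewrite /inner -[u *m K *m v^T]trmxK mxE !trmx_mul trmxK Ksym mulmxA.
Qed.

Hypothesis Kpos : forall u, u != 0 -> 0 < inner u u.

Lemma ip_ge0 u : 0 <= inner u u.
Proof. by have [->|/Kpos/ltW//] := eqVneq u 0; rewrite ip0l. Qed.

Lemma ip_eq0 u : inner u u = 0 -> u = 0.
Proof.
by move=> e; apply/eqP; apply/negPn/negP => /Kpos; rewrite e ltxx.
Qed.

Lemma ip_cauchy u v : inner u v ^+ 2 <= inner u u * inner v v.
Proof.
have [->|v0] := eqVneq v 0; first by rewrite !ip0r mulr0 expr0n.
have vv := Kpos v0.
have := ip_ge0 (inner v v *: u - inner u v *: v).
rewrite ipDl !ipDr !ipNl !ipNr !ipZl !ipZr (ipC v u).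
rewrite [X in 0 <= X -> _](_ : _ = inner v v * (inner u u * inner v v - inner u v ^+ 2)).
  by rewrite pmulr_rge0 // subr_ge0.
by ring.
Qed.

(** The quadratic form attains a positive minimum on the compact unit sphere of the sup norm;
    homogeneity does the rest. This ties the inner product to the norm that defines the topology. *)
Lemma ip_lower : exists2 c, 0 < c & forall u, c * `|u| ^+ 2 <= inner u u.
Proof.
pose W := [set u : 'rV[R]_n | `|u| = 1].
have norm1 u : u != 0 -> W (`|u|^-1 *: u).
  move=> u0; rewrite /W /= normrZ normfV normr_id mulVf // normr_eq0 //.
(* The sphere is empty only when n = 0; then every vector is 0 and any constant works. *)
have [[u1 Wu1]|noW] := pselect (W !=set0); last first.
  exists 1 => // u; have [->|u0] := eqVneq u 0.
    by rewrite normr0 expr0n mulr0 ip0l.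
  by exfalso; apply: noW; exists (`|u|^-1 *: u); exact: norm1.
have cptW : compact W.
  apply: bounded_closed_compact.
    exists 1; split; first by rewrite num_real.
    by move=> x x1 u /= ->; exact: ltW.
  apply: (@closed_comp _ _ (fun u : 'rV[R]_n => `|u|) [set x | x = 1]).
    by move=> u _; exact: norm_continuous.
  exact: closed_eq.
have [] := @EVT_min_rV R n (fun u => inner u u) W _ cptW.
- by exists u1.
- apply: continuous_subspaceT; apply: ip_continuous; exact: mxcts_id.
move=> u0 /set_mem Wu0 u0min.
have u0n0 : u0 != 0 by rewrite -normr_gt0 Wu0.
exists (inner u0 u0); first exact: Kpos.
move=> u; have [->|un0] := eqVneq u 0.
  by rewrite normr0 expr0n mulr0 ip0l.
have := u0min _ (mem_set (norm1 _ un0)).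
rewrite ipZl ipZr mulrA -expr2 exprVn mulrC ler_pdivlMr //.
by rewrite exprn_gt0 // normr_gt0.
Qed.

Definition selfadj A := A *m K = K *m A^T.

Lemma selfadjP A : selfadj A <-> forall u v, inner (u *m A) v = inner u (v *m A).
Proof.
split=> [sA u v|H]; rewrite /inner.
  by rewrite trmx_mul -!mulmxA (mulmxA A) sA !mulmxA.
apply/matrixP => i j.
have := H (delta_mx 0 i) (delta_mx 0 j).
rewrite /inner trmx_mul -!mulmxA (mulmxA A) (mulmxA K) !mulmxA.
by rewrite -!(mulmxA (delta_mx 0 i)) -!rowE trmx_delta -!colE !mxE.
Qed.

Lemma nonneg_quadratic_slope (b0 c : R) :
  (forall t : R, 0 <= t * b0 *+ 2 + t ^+ 2 * c) -> b0 = 0.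
Proof.
move=> H; apply/eqP; apply/negPn/negP => b0n.
have cge : 0 <= c.
  have h1 := H 1; have h2 := H (-1).
  by move: h1 h2; rewrite !mulr2n; lra.
(* The minimizer would be -b0/c; the added 1 covers c = 0 and still gives the negative value -b0^2
   (c + 2)/(c + 1)^2. *)
have := H (- b0 / (c + 1)).
rewrite leNgt => /negP; apply.
have c1 : 0 < c + 1 by lra.
have -> : - b0 / (c + 1) * b0 *+ 2 + (- b0 / (c + 1)) ^+ 2 * c =
   - (b0 ^+ 2 * (c + 2)) / (c + 1) ^+ 2 by field; apply/eqP; lra.
rewrite mulNr oppr_lt0 divr_gt0 ?exprn_gt0 // mulr_gt0 ?exprn_even_gt0 //.
lra.
Qed.

(** The rows of [E] are eigenvectors already found, so by self-adjointness their orthogonal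
    complement is stable under [A]. A minimizer of the Rayleigh quotient on the unit vectors of this
    complement is a new eigenvector. *)
Lemma eigenvector_exists k (E : 'M[R]_(k, n)) (d : 'rV[R]_k) A :
  selfadj A -> (k < n)%N -> E *m A = diag_mx d *m E ->
  exists u (l : R), [/\ u *m K *m E^T = 0, inner u u = 1 & u *m A = l *: u].
Proof.
move=> sA kn EA.
pose W := [set u : 'rV[R]_n | u *m K *m E^T = 0 /\ inner u u = 1].
have stabW u : u *m K *m E^T = 0 -> u *m A *m K *m E^T = 0.
  move=> uE; rewrite -(mulmxA u) sA mulmxA -mulmxA -trmx_mul EA trmx_mul.
  by rewrite mulmxA uE mul0mx.
have normW u : u *m K *m E^T = 0 -> u != 0 -> W ((Num.sqrt (inner u u))^-1 *: u).
  move=> uE u0; split; first by rewrite -!scalemxAl uE scaler0.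
  rewrite ipZl ipZr mulrA -expr2 exprVn sqr_sqrtr ?ip_ge0 //.
  by rewrite mulVf // gt_eqF // Kpos.
have [w [wE w0]] : exists w : 'rV[R]_n, w *m K *m E^T = 0 /\ w != 0.
  have : kermx (K *m E^T) != 0.
    rewrite -mxrank_eq0 mxrank_ker subn_eq0 -ltnNge.
    by apply: leq_ltn_trans kn; exact: rank_leq_col.
  case/rowV0Pn => w /sub_kermxP; rewrite mulmxA => wE w0.
  by exists w.
have cptW : compact W.
  apply: bounded_closed_compact.
    have [c c0 cP] := ip_lower.
    (* Either |u| <= 1, or |u| <= |u|^2 <= 1/c. *)
    exists (1 + c^-1); split; first by rewrite num_real.
    move=> x xc u [_ u1]; have := cP u; rewrite u1 => cu.
    apply: le_trans (ltW xc).
    have [u_le1|u_gt1] := leP `|u| 1; first by rewrite ler_wpDr // invr_ge0 ltW.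
    have : `|u| <= `|u| ^+ 2 by rewrite expr2 ler_peMl // ltW.
    move=> uu; apply: (le_trans uu); rewrite ler_wpDl //.
    by rewrite -[leRHS]mul1r ler_pdivlMr // mulrC.
  have -> : W = [set u | u *m K *m E^T = 0] `&` [set u | u *m K *m u^T = 1%:M].
    apply/seteqP; split => u /= [H1 H2]; split => //.
      by apply/matrixP => i j; rewrite !ord1 -/(inner u u) H2 mxE.
    by rewrite /inner H2 mxE.
  apply: closedI; apply: closed_mxeq; try exact: mxcts_const.
    apply: mxctsM; last exact: mxcts_const.
    by apply: mxctsM; [exact: mxcts_id|exact: mxcts_const].
  by apply: ip_mxcts; exact: mxcts_id.
have [] := @EVT_min_rV R n (fun u => inner (u *m A) u) W _ cptW.
- by eexists; exact: normW wE w0.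
- apply: continuous_subspaceT; apply: ip_continuous; last exact: mxcts_id.
  by apply: mxctsM; [exact: mxcts_id|exact: mxcts_const].
move=> u /set_mem [uE u1] umin; set l := inner (u *m A) u in umin.
exists u, l; split=> //.
have ge0 v : v *m K *m E^T = 0 -> l * inner v v <= inner (v *m A) v.
  move=> vE; have [->|v0] := eqVneq v 0; first by rewrite mul0mx !ip0l mulr0.
  have := umin _ (mem_set (normW _ vE v0)).
  rewrite -scalemxAl ipZl ipZr mulrA -expr2 exprVn sqr_sqrtr ?ip_ge0 //.
  by rewrite mulrC ler_pdivlMr // Kpos.
apply/eqP; rewrite -subr_eq0; apply/eqP; apply: ip_eq0.
(* The residual [v] lies in the complement, so u + t v is an admissible competitor. The slope at t =
   0 of the resulting quadratic is 2<v, v>, which minimality forces to vanish. *)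
have [v vdef] : exists v, v = u *m A - l *: u by eexists.
rewrite -vdef; have vE : v *m K *m E^T = 0.
  by rewrite vdef !mulmxBl stabW // -!scalemxAl uE scaler0 subrr.
apply: (@nonneg_quadratic_slope _ (inner (v *m A) v - l * inner v v)) => t.
have tE : (u + t *: v) *m K *m E^T = 0.
  by rewrite !mulmxDl uE -!scalemxAl vE scaler0 addr0.
have := ge0 _ tE; rewrite -subr_ge0.
rewrite [X in 0 <= X -> _](_ : _ = t * inner v v *+ 2 +
  t ^+ 2 * (inner (v *m A) v - l * inner v v)) //.
rewrite mulmxDl -scalemxAl !(ipDl, ipDr, ipZl, ipZr) -/l u1.
have -> : inner (v *m A) u = inner (u *m A) v.
  by rewrite (selfadjP A).1 // ipC.
have -> : inner v v = inner (u *m A) v - l * inner u v by rewrite {1}vdef ipDl ipNl ipZl.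
rewrite (ipC v u); ring.
Qed.

Lemma selfadj_diag A : selfadj A ->
  exists (E : 'M[R]_n) (d : 'rV[R]_n), E *m K *m E^T = 1%:M /\ E *m A = diag_mx d *m E.
Proof.
move=> sA.
suff H k : (k <= n)%N -> exists (E : 'M[R]_(k, n)) (d : 'rV[R]_k),
    E *m K *m E^T = 1%:M /\ E *m A = diag_mx d *m E by exact: H.
elim: k => [_|k IH kn].
  by exists 0, 0; split; apply/matrixP => -[].
have [E [d [EE EA]]] := IH (ltnW kn).
have [u [l [uE u1 uA]]] := eigenvector_exists sA kn EA.
rewrite -addn1; exists (col_mx E u), (row_mx d (l%:M)); split.
  rewrite mul_col_mx tr_col_mx mul_col_row EE uE.
  have -> : E *m K *m u^T = 0.
    by apply: trmx_inj; rewrite !trmx_mul trmxK Ksym mulmxA uE trmx0.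
  rewrite [u *m K *m u^T](_ : _ = 1%:M) -?scalar_mx_block //.
  by apply/matrixP => i j; rewrite !ord1 -/(inner u u) u1 mxE.
rewrite mul_col_mx EA uA diag_mx_row mul_block_col !mul0mx addr0 add0r.
congr col_mx; apply/matrixP => i j; rewrite !ord1 !mxE big_ord1 !mxE.
by rewrite eqxx !mulr1n.
Qed.

Lemma selfadj_diagonalizable A : selfadj A -> diagonalizable_R A.
Proof.
move=> /selfadj_diag[E [d [EE EA]]]; exists E, d; split=> //.
by apply: (proj1 (mulmx1_unit _)); rewrite -mulmxA in EE; exact: EE.
Qed.

Definition psd A := forall u, 0 <= inner (u *m A) u.

(** In an orthonormal eigenbasis all eigenvalues are nonnegative, and their sum is the trace, so
    each lies between 0 and [\tr A]. *)
Lemma psd_trace A : selfadj A -> psd A ->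
  0 <= \tr A /\
  forall u, inner (u *m A) (u *m A) <= \tr A * inner (u *m A) u /\
            inner (u *m A) u <= \tr A * inner u u.
Proof.
move=> /selfadj_diag[E [d [EE EA]]] pA.
have EiE : E *m (K *m E^T) = 1%:M by rewrite mulmxA.
have iEE := mulmx1C EiE.
have trA : \tr A = \sum_i d 0 i.
  have -> : A = (K *m E^T) *m (diag_mx d *m E).
    by rewrite -EA mulmxA iEE mul1mx.
  by rewrite mxtrace_mulC -mulmxA EiE mulmx1 mxtrace_diag.
have ipE c c' : inner (c *m E) (c' *m E) = \sum_i c 0 i * c' 0 i.
  rewrite /inner trmx_mul !mulmxA -(mulmxA c) -(mulmxA c) EE mulmx1 mxE.
  by apply: eq_bigr => i _; rewrite mxE.
have AE c : c *m E *m A = (\row_i (c 0 i * d 0 i)) *m E.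
  rewrite -mulmxA EA mulmxA; congr (_ *m _).
  by apply/rowP => i; rewrite mul_mx_diag !mxE.
have d0 i : 0 <= d 0 i.
  have := pA (delta_mx 0 i *m E); rewrite AE ipE (bigD1 i) //= big1 => [|j ji].
    by rewrite !mxE !eqxx mulr1 mul1r addr0.
  by rewrite !mxE (negPf ji) andbF !mul0r.
have dle i : d 0 i <= \tr A by rewrite trA (bigD1 i) //= lerDl sumr_ge0.
split; first by rewrite trA sumr_ge0.
move=> u; have -> : u = (u *m (K *m E^T)) *m E by rewrite -mulmxA iEE mulmx1.
move: (u *m _) => c; rewrite AE !ipE !mulr_sumr.
split; apply: ler_sum => i _; rewrite !mxE.
  rewrite [leLHS](_ : _ = d 0 i * (c 0 i ^+ 2 * d 0 i)); last by ring.
  rewrite [leRHS](_ : _ = \tr A * (c 0 i ^+ 2 * d 0 i)); last by ring.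
  by rewrite ler_wpM2r // mulr_ge0 // sqr_ge0.
rewrite [leLHS](_ : _ = d 0 i * (c 0 i ^+ 2)); last by ring.
rewrite [leRHS](_ : _ = \tr A * (c 0 i ^+ 2)); last by ring.
by rewrite ler_wpM2r // sqr_ge0.
Qed.

Lemma form_le (F : 'M[R]_n) u :
  `|(u *m F *m u^T) 0 0| <= (\sum_i \sum_j `|F i j|) * `|u| ^+ 2.
Proof.
have ule i : `|u 0 i| <= `|u|.
  by rewrite [leRHS]/Num.Def.normr /= mx_normrE; exact: (le_bigmax _ _ (0, i)).
rewrite mxE; apply: le_trans (ler_norm_sum _ _ _) _.
rewrite exchange_big mulr_suml; apply: ler_sum => j _ /=.
rewrite !mxE normrM mulr_suml.
apply: (@le_trans _ _ ((\sum_i `|u 0 i * F i j|) * `|u 0 j|)).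
  by rewrite ler_wpM2r // ler_norm_sum.
rewrite mulr_suml; apply: ler_sum => i _.
rewrite normrM [leLHS](_ : _ = `|F i j| * (`|u 0 i| * `|u 0 j|)); last by ring.
by rewrite ler_wpM2l // expr2 ler_pM.
Qed.

(* Positivity is an open condition because |uS| >= |u| bounds the spectrum away from 0. *)
Lemma psd_path (S : R -> 'M[R]_n) :
  mxcts S -> (forall t, selfadj (S t)) ->
  (forall t u, inner u u <= inner (u *m S t) (u *m S t)) ->
  psd (S 0) -> psd (S 1).
Proof.
move=> cS sS lowS S0.
pose C := [set t | psd (S t)].
have closedC : closed C.
  rewrite (_ : C = \bigcap_(u in [set: 'rV[R]_n]) [set t | 0 <= (u *m S t *m K *m u^T) 0 0]).
    apply: closed_bigI => u _; apply: closed_mxge0.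
    apply: ip_mxcts; last exact: mxcts_const.
    by apply: mxctsM => //; exact: mxcts_const.
  by apply/seteqP; split=> t /=; [move=> Ct u _; exact: Ct|move=> H u; exact: H].
have openC : open C.
  rewrite openE => t0 Ct0.
  have [c c0 cP] := ip_lower.
  have [tr0 trP] := psd_trace (sS t0) Ct0.
  pose tau := \tr (S t0) + 1.
  have tau0 : 0 < tau by rewrite ltr_wpDl.
  pose phi t := \sum_i \sum_j `|((S t - S t0) *m K) i j|.
  have phi0 : phi t0 = 0.
    by rewrite /phi big1 // => i _; rewrite big1 // => j _; rewrite subrr mul0mx mxE normr0.
  have cphi : continuous phi.
    move=> t; apply: cvg_big => [|i _]; first exact: add_continuous.
    apply: cvg_big => [|j _]; first exact: add_continuous.
    apply: cvg_norm; have : mxcts (fun t => (S t - S t0) *m K).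
      apply: mxctsM; last exact: mxcts_const.
      by apply: mxctsD => //; exact: mxcts_const.
    by move/(_ i j t).
  (* At [t0], c|u|^2 <= <u, u> <= <uS, uS> <= tau <uS, u>, so the form of S(t0) is at least
     (c/tau)|u|^2, and a perturbation of size below c/tau cannot make it negative. The 1 added to
     the trace keeps [tau] positive. *)
  have : \forall t \near t0, phi t < c / tau.
    have /cvgr_lt /(_ (c / tau)) := cphi t0; apply.
    by rewrite phi0 divr_gt0.
  apply: filterS => t phit u.
  have -> : inner (u *m S t) u = inner (u *m S t0) u + (u *m ((S t - S t0) *m K) *m u^T) 0 0.
    by rewrite mulmxA -/(inner _ _) mulmxBr ipDl ipNl; ring.
  have h1 := form_le ((S t - S t0) *m K) u; rewrite -/(phi t) in h1.
  have h2 := (trP u).1; have h3 := lowS t0 u; have h4 := cP u.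
  have h5 := Ct0 u.
  have h6 : phi t * `|u| ^+ 2 <= c / tau * `|u| ^+ 2 by rewrite ler_wpM2r ?sqr_ge0 // ltW.
  have h7 : inner u u <= tau * inner (u *m S t0) u.
    by apply: (le_trans h3); apply: (le_trans h2); rewrite ler_wpM2r // lerDl.
  have h8 : c / tau * `|u| ^+ 2 <= inner (u *m S t0) u.
    rewrite mulrAC ler_pdivrMr // mulrC [leRHS]mulrC.
    by rewrite mulrC; apply: le_trans h4 _.
  move: h1; rewrite ler_norml => /andP[h1 _].
  lra.
have := @segment_connected R 0 1 (`[0, 1] `&` C).
have H0 : `[0, 1]%classic (0 : R) by rewrite /= in_itv /= lexx ler01.
have H1 : `[0, 1]%classic (1 : R) by rewrite /= in_itv /= lexx ler01.
move=> H; have : (`[0, 1] `&` C) 1.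
  by rewrite H //; [exists 0|exists C|exists C].
by case.
Qed.

End InnerProduct.

(** * Lie brackets, the Killing form and one-parameter groups *)

Section LieAlgebra.
Variables (R : realType) (n : nat) (br : 'rV[R]_n -> 'rV[R]_n -> 'rV[R]_n).
Hypothesis lie : is_lie_bracket br.
Implicit Types (x y z u v w : 'rV[R]_n) (g X : 'M[R]_n).

Lemma brDl x y z : br (x + y) z = br x z + br y z.
Proof. by case: lie => H _ _ _; have := H 1 x y z; rewrite !scale1r. Qed.
Lemma brDr x y z : br z (x + y) = br z x + br z y.
Proof. by case: lie => _ H _ _; have := H 1 z x y; rewrite !scale1r. Qed.
Lemma brxx x : br x x = 0.
Proof. by case: lie. Qed.
Lemma br0l z : br 0 z = 0.
Proof. by apply: (addrI (br 0 z)); rewrite -brDl !addr0. Qed.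
Lemma br0r z : br z 0 = 0.
Proof. by apply: (addrI (br z 0)); rewrite -brDr !addr0. Qed.
Lemma brZl a x z : br (a *: x) z = a *: br x z.
Proof. by case: lie => H _ _ _; have := H a x 0 z; rewrite !addr0 br0l addr0. Qed.
Lemma brZr a x z : br z (a *: x) = a *: br z x.
Proof. by case: lie => _ H _ _; have := H a z x 0; rewrite !addr0 br0r addr0. Qed.
Lemma brNl x z : br (- x) z = - br x z.
Proof. by rewrite -scaleN1r brZl scaleN1r. Qed.
Lemma brNr x z : br z (- x) = - br z x.
Proof. by rewrite -scaleN1r brZr scaleN1r. Qed.
Lemma brC x y : br x y = - br y x.
Proof.
have := brxx (x + y); rewrite brDl !brDr !brxx addr0 add0r => /eqP.
by rewrite addr_eq0 => /eqP.
Qed.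
Lemma br_leibniz x y z : br x (br y z) = br (br x y) z + br y (br x z).
Proof.
case: lie => _ _ _ /(_ x y z) J; apply/eqP.
rewrite -subr_eq0 (brC (br x y)) (brC x z) brNr opprD !opprK addrA addrAC.
by apply/eqP.
Qed.

Lemma br_suml (I : finType) (F : I -> 'rV[R]_n) z :
  br (\sum_i F i) z = \sum_i br (F i) z.
Proof.
elim/big_rec2: _ => [|i a b _ <-]; [exact: br0l|exact: brDl].
Qed.
Lemma br_sumr (I : finType) (F : I -> 'rV[R]_n) z :
  br z (\sum_i F i) = \sum_i br z (F i).
Proof.
elim/big_rec2: _ => [|i a b _ <-]; [exact: br0r|exact: brDr].
Qed.

Lemma mul_ad v x : v *m ad br x = br x v.
Proof.
rewrite [in RHS](row_sum_delta v) br_sumr mulmx_sum_row; apply: eq_bigr => i _.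
by rewrite brZr; congr (_ *: _); apply/rowP => j; rewrite !mxE.
Qed.

(** A form with [x] as a matrix factor, so that continuity and differentiability in [x] pass to
    [ad br x]. *)
Lemma adE x (i j : 'I_n) : ad br x i j = (x *m - ad br (delta_mx 0 i)) 0 j.
Proof. by rewrite mulmxN mul_ad -brC !mxE. Qed.

Lemma adN x : ad br (- x) = - ad br x.
Proof. by apply/matrixP => i j; rewrite !mxE brNl mxE. Qed.
Lemma adZ a x : ad br (a *: x) = a *: ad br x.
Proof. by apply/matrixP => i j; rewrite !mxE brZl mxE. Qed.

Lemma ad_br x y : ad br (br x y) = ad br y *m ad br x - ad br x *m ad br y.
Proof.
apply/row_matrixP => i; rewrite !rowE mulmxBr !mulmxA !mul_ad.
by rewrite br_leibniz addrK.
Qed.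

Lemma killingC x y : killing br x y = killing br y x.
Proof. exact: mxtrace_mulC. Qed.

Lemma killing_br x y z : killing br (br x y) z = killing br x (br y z).
Proof.
rewrite /killing !ad_br mulmxBl mulmxBr !linearB /= !mulmxA.
by rewrite -(mulmxA (ad br y)) mxtrace_mulC.
Qed.

Lemma killing_sumr (I : finType) (F : I -> 'rV[R]_n) x :
  killing br x (\sum_i F i) = \sum_i killing br x (F i).
Proof.
rewrite /killing -raddf_sum -mulmx_sumr; congr (\tr (_ *m _)).
by apply/matrixP => i j; rewrite mxE br_suml !summxE; apply: eq_bigr => k _; rewrite mxE.
Qed.
Lemma killingZr a x y : killing br x (a *: y) = a * killing br x y.
Proof. by rewrite /killing adZ -scalemxAr mxtraceZ. Qed.

Definition killing_mx : 'M[R]_n :=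
  \matrix_(i, j) killing br (delta_mx 0 i) (delta_mx 0 j).

Lemma killingE x y : killing br x y = (x *m killing_mx *m y^T) 0 0.
Proof.
have kE u v : killing br u v = \sum_j v 0 j * killing br u (delta_mx 0 j).
  rewrite {1}(row_sum_delta v) killing_sumr.
  by apply: eq_bigr => j _; rewrite killingZr.
rewrite kE mxE; apply: eq_bigr => j _; rewrite !mxE mulrC; congr (_ * _).
rewrite killingC kE; apply: eq_bigr => i _; rewrite !mxE killingC //.
Qed.

Definition lie_hom g := forall x y, br (x *m g) (y *m g) = br x y *m g.

Lemma lie_hom1 : lie_hom 1%:M.
Proof. by move=> x y; rewrite !mulmx1. Qed.
Lemma lie_homM g g' : lie_hom g -> lie_hom g' -> lie_hom (g *m g').
Proof. by move=> H H' x y; rewrite !mulmxA H' H. Qed.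

Lemma ad_hom g x : lie_hom g -> g *m ad br (x *m g) = ad br x *m g.
Proof.
by move=> H; apply/row_matrixP => i; rewrite !rowE !mulmxA !mul_ad H.
Qed.

Lemma ad_aut g x : lie_hom g -> g \in unitmx ->
  ad br (x *m g) = invmx g *m ad br x *m g.
Proof. by move=> H U; rewrite -mulmxA -ad_hom // mulKmx. Qed.

Lemma killing_aut g x y : lie_hom g -> g \in unitmx ->
  killing br (x *m g) (y *m g) = killing br x y.
Proof.
move=> H U; rewrite /killing !ad_aut // !mulmxA mulmxK // mxtrace_mulC.
by rewrite !mulmxA mulmxV // mul1mx.
Qed.

Lemma mxcts_ad (T : topologicalType) (F : T -> 'rV[R]_n) :
  mxcts F -> mxcts (fun t => ad br (F t)).
Proof.
move=> HF i j; under eq_fun do rewrite adE.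
by apply: mxctsM => //; exact: mxcts_const.
Qed.

Lemma mxder_ad (F : R -> 'rV[R]_n) t D :
  mxder F t D -> mxder (fun s => ad br (F s)) t (ad br D).
Proof.
move=> HF i j; under eq_fun do rewrite adE.
have := mxderM HF (mxder_const (- ad br (delta_mx 0 i)) t).
by move=> /(_ 0 j); rewrite mulmx0 addr0 adE.
Qed.

Section OneParameterGroup.
Variable X : 'M[R]_n.
Let e t := expmx (t *: X).
Let e' t := expmx (t *: - X).

Let der_e t : mxder e t (e t *m X).
Proof. by rewrite -expmx_comm; exact: mxder_expmx. Qed.

Let der_e' t : mxder e' t (- X *m e' t).
Proof. exact: mxder_expmx. Qed.

Lemma expmxNK t : expmx (t *: X) *m expmx (t *: - X) = 1%:M.
Proof.
have := @mxder0_const R n n (fun s => e s *m e' s) t 0.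
rewrite /e /e' !expmx0 mulmx1; apply=> u.
have := mxderM (der_e u) (der_e' u).
by rewrite mulNmx mulmxN mulmxA subrr.
Qed.

(** The curve s -> [u e^{sX}, v e^{sX}] e^{-sX} has zero derivative because X is a derivation, so it
    keeps its value [u, v] at s = 0. *)
Lemma expmx_aut t : (forall u v, br u v *m X = br (u *m X) v + br u (v *m X)) ->
  lie_hom (expmx (t *: X)).
Proof.
move=> HX u v.
suff H : br (u *m e t) (v *m e t) *m e' t = br u v.
  by rewrite -[in RHS]H -mulmxA /e' (mulmx1C (expmxNK t)) mulmx1.
have := @mxder0_const R 1 n (fun s => v *m e s *m ad br (u *m e s) *m e' s) t 0.
rewrite !mul_ad /e /e' !expmx0 !mulmx1; apply=> s.
have du w : mxder (fun s => w *m e s) s (w *m e s *m X).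
  have := mxderM (mxder_const w s) (der_e s).
  by rewrite mul0mx add0r mulmxA.
have := mxderM (mxderM (du v) (mxder_ad (du u))) (der_e' s).
rewrite !mul_ad mulNmx mulmxN mulmxA HX mulmxDl.
by rewrite [br _ _ *m _ + _]addrC -mulmxDl addrC mulmxDl addrC subrr.
Qed.

Lemma expmx_form t (G : 'M[R]_n) : X *m G = - (G *m X^T) ->
  expmx (t *: X) *m G *m (expmx (t *: X))^T = G.
Proof.
move=> HX.
have := @mxder0_const R n n (fun s => e s *m G *m (e s)^T) t 0.
rewrite /e expmx0 mul1mx trmx1 mulmx1; apply=> s.
have := mxderM (mxderM (der_e s) (mxder_const G s)) (mxder_tr (der_e s)).
by rewrite mulmx0 addr0 trmx_mul -(mulmxA (e s)) HX mulmxN mulNmx !mulmxA addNr.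
Qed.

Lemma expmx_commute t (G : 'M[R]_n) : X *m G = G *m X ->
  expmx (t *: X) *m G = G *m expmx (t *: X).
Proof.
move=> HX.
have H : e' t *m G *m e t = G.
  have := @mxder0_const R n n (fun s => e' s *m G *m e s) t 0.
  rewrite /e /e' !expmx0 mul1mx mulmx1; apply=> s.
  have := mxderM (mxderM (der_e' s) (mxder_const G s)) (mxder_expmx X s).
  have eX : X *m e' s = e' s *m X.
    by apply: oppr_inj; rewrite -mulNmx -mulmxN; exact: expmx_comm.
  rewrite mulmx0 addr0 mulNmx eX -/(e s) !mulNmx !mulmxA -(mulmxA _ X G) HX.
  by rewrite !mulmxA addNr.
by rewrite -[in LHS]H !mulmxA expmxNK mul1mx.
Qed.

Lemma mxcts_expmx : mxcts (fun t : R => expmx (t *: X)).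
Proof. exact: mxder_mxcts der_e. Qed.

End OneParameterGroup.
End LieAlgebra.

(** * The inner product attached to the Cartan involution *)

Section Reductive.
Variables (R : realType) (n : nat) (br : 'rV[R]_n -> 'rV[R]_n -> 'rV[R]_n).
Hypothesis lie : is_lie_bracket br.
Implicit Types (x y z u v w : 'rV[R]_n) (g X : 'M[R]_n).

Definition derived_mx : 'M[R]_n := (\sum_(i < n) ad br (delta_mx 0 i))%MS.

Lemma br_derived x y : (br x y <= derived_mx)%MS.
Proof.
rewrite (row_sum_delta x) br_suml // summx_sub // => i _.
rewrite (brZl lie) scalemx_sub // -(mul_ad lie).
by apply: (submx_trans (submxMl _ _)); exact: (sumsmx_sup i).
Qed.

Lemma derived_mxP x : (x <= derived_mx)%MS -> in_derived br x.
Proof.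
case/sub_sumsmxP => c ->; exists (\matrix_(i, j) c i 0 j).
apply: eq_bigr => i _; rewrite (mul_ad lie) [in LHS](row_sum_delta (c i)) br_sumr //.
by apply: eq_bigr => j _; rewrite mxE brZr.
Qed.

(** An ideal [J] complementary to [g, g] is central: brackets with it lie in both [J] and [g, g]. *)
Lemma center_derived_decomp : reductive br ->
  forall u, exists d z, [/\ u = d + z, (d <= derived_mx)%MS & in_center br z].
Proof.
move=> /(_ derived_mx) [|J [idJ /eqP DJ0 /eqmxP DJ] u]; first by move=> x v _; exact: br_derived.
have : (u <= derived_mx + J)%MS by rewrite DJ submx1.
case/sub_addsmxP => [[a b]] /= ->.
exists (a *m derived_mx), (b *m J); split=> //; first exact: submxMl.
move=> y; rewrite (brC lie); apply/eqP; rewrite oppr_eq0 -submx0 -DJ0 sub_capmx.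
by rewrite br_derived idJ // submxMl.
Qed.

Hypothesis red : reductive br.
Variable Th : 'M[R]_n.
Hypothesis cartan : cartan_involution br Th.
Hypothesis center_Th : forall z, in_center br z -> z *m Th = - z.

Lemma hom_Th : lie_hom br Th. Proof. by case: cartan => -[[]]. Qed.
Lemma unit_Th : Th \in unitmx. Proof. by case: cartan => -[[]]. Qed.
Lemma Th_sq : Th *m Th = 1%:M. Proof. by case: cartan => -[]. Qed.

(** A linear map with kernel exactly [g, g]. Its Gram matrix supplies positivity on the center,
    where the Killing form vanishes, and it is invisible to brackets. *)
Definition center_part := cokermx derived_mx.

Definition gram : 'M[R]_n :=
  center_part *m center_part^T - killing_mx br *m Th^T.

Local Notation ip := (inner gram).

Lemma gramE u v :
  ip u v = (u *m center_part *m (v *m center_part)^T) 0 0 - killing br u (v *m Th).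
Proof.
rewrite (killingE lie) /inner mulmxBr mulmxBl !trmx_mul !mulmxA.
by rewrite [LHS]mxE; congr (_ + _); rewrite mxE.
Qed.

Lemma killing_Th u v : killing br u (v *m Th) = killing br (u *m Th) v.
Proof.
rewrite -(killing_aut lie u _ hom_Th unit_Th) -mulmxA Th_sq mulmx1 //.
Qed.

Lemma gram_sym : gram^T = gram.
Proof.
apply/matrixP => i j; rewrite mxE !gram_entry !gramE killing_Th killingC.
congr (_ - _); move: (_ *m center_part) (_ *m center_part) => a b.
by rewrite !mxE; apply: eq_bigr => k _; rewrite !mxE mulrC.
Qed.

Lemma killing_center z u : in_center br z -> killing br z u = 0.
Proof.
move=> Hz; rewrite /killing (_ : ad br z = 0) ?mul0mx ?mxtrace0 //.
by apply/matrixP => i j; rewrite !mxE Hz mxE.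
Qed.

Lemma gram_pos u : u != 0 -> 0 < ip u u.
Proof.
have [d [z [-> Hd Hz]]] := center_derived_decomp red u => u0.
have kd : d != 0 -> 0 < - killing br d (d *m Th).
  by move=> d0; case: cartan => _; apply=> //; exact: derived_mxP.
have kdz : - killing br (d + z) ((d + z) *m Th) = - killing br d (d *m Th).
  have kD a b c : killing br a (b + c) = killing br a b + killing br a c.
    by rewrite !(killingE lie) linearD mulmxDr mxE.
  rewrite mulmxDl (center_Th Hz) !kD.
  have kD' a b c : killing br (b + c) a = killing br b a + killing br c a.
    by rewrite !(killingC _ _ a) kD.
  have zN : in_center br (- z) by move=> y; rewrite (brNl lie) Hz oppr0.
  rewrite !kD' !(killing_center _ Hz) (killingC _ d (- z)).
  by rewrite !(killing_center _ zN) !addr0.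
rewrite gramE kdz.
have qE (q : 'rV[R]_n) : (q *m q^T) 0 0 = \sum_i q 0 i ^+ 2.
  by rewrite mxE; apply: eq_bigr => i _; rewrite mxE expr2.
set q := (d + z) *m center_part.
have q0 : 0 <= (q *m q^T) 0 0 by rewrite qE sumr_ge0 // => i _; exact: sqr_ge0.
have [d0|/kd kd0] := eqVneq d 0; last by rewrite ltr_wpDl.
rewrite d0 mul0mx killing_center ?oppr0 ?addr0; last by move=> y; rewrite br0l.
rewrite lt_neqAle q0 andbT eq_sym; apply/eqP; rewrite qE => /eqP.
rewrite psumr_eq0 => [/allP H|i _]; last exact: sqr_ge0.
have qz : q = 0.
  apply/rowP => i; rewrite [RHS]mxE; apply/eqP.
  by move: (H i (mem_index_enum _)); rewrite implyTb sqrf_eq0.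
(* A nonzero central [z] in [g, g] would be Killing-orthogonal to everything, against the Cartan
   condition on [g, g]. *)
move: qz u0; rewrite /q d0 add0r => /eqP; rewrite -submxE => zD z0.
case: cartan => _ /(_ z (derived_mxP zD) z0).
by rewrite killing_center // oppr0 ltxx.
Qed.

(** The [center_part] terms vanish on brackets; invariance of the Killing form gives the rest. Hence
    ad x is symmetric when theta x = -x and skew when theta x = x. *)
Lemma gram_ad x u v : ip (br x u) v = - ip u (br (x *m Th) v).
Proof.
have brc a b : br a b *m center_part = 0.
  by apply/eqP; rewrite -submxE; exact: br_derived.
rewrite !gramE !brc mul0mx trmx0 mulmx0 !mxE !sub0r opprK.
rewrite -hom_Th -mulmxA Th_sq mulmx1 -(killing_br lie) (brC lie x u).
by rewrite /killing (adN lie) mulNmx raddfN opprK.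
Qed.

End Reductive.

(** * The grading by the Euler element *)

Section EulerGrading.
Variables (R : realType) (n : nat) (br : 'rV[R]_n -> 'rV[R]_n -> 'rV[R]_n).
Hypothesis lie : is_lie_bracket br.
Variables (h : 'rV[R]_n) (T : 'M[R]_n).
Hypothesis eul : euler br h.
Hypothesis tauT : is_tau_h br h T.
Implicit Types (x y z u v w : 'rV[R]_n) (g X : 'M[R]_n).

Local Notation N := (ad br h).

Lemma euler_cube : N *m N *m N = N.
Proof.
case: eul => _ [P [d [uP PN dP]]].
apply: (can_inj (mulKmx uP)).
rewrite !mulmxA PN -(mulmxA _ P) PN mulmxA -(mulmxA _ P) PN mulmxA; congr (_ *m _).
rewrite !mulmx_diag; congr diag_mx; apply/rowP => i; rewrite !mxE.
by case: (dP i) => [->|[->|->]]; ring.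
Qed.

Lemma euler_cubev v : v *m N *m N *m N = v *m N.
Proof. by rewrite -!mulmxA (mulmxA N) euler_cube. Qed.

(** Since N^3 = N, the vectors vN^2 + vN, vN^2 - vN and v - vN^2 have degrees 1, -1 and 0, and [T]
    is prescribed on each of them. *)
Lemma tau_hE : T = 1%:M - 2 *: (N *m N).
Proof.
case: tauT => T1 T0 Tm; apply/row_matrixP => i; rewrite !rowE.
move: (delta_mx 0 i) => v; rewrite mulmxBr mulmx1 -scalemxAr mulmxA.
set a := v *m N *m N; have aN : a *m N = v *m N by exact: euler_cubev.
have aNN : v *m N *m N = a by [].
have E1 : (a + v *m N) *m T = - (a + v *m N).
  by apply: T1; rewrite mulmxDl aN aNN addrC.
have Em : (a - v *m N) *m T = - (a - v *m N).
  by apply: Tm; rewrite mulmxBl aN aNN opprB.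
have E0 : (v - a) *m T = v - a by apply: T0; rewrite mulmxBl aN subrr.
have Ea : a *m T = - a.
  have : 2 *: (a *m T) = 2 *: (- a).
    move: (congr2 +%R E1 Em); rewrite -mulmxDl -opprD addrACA subrr addr0.
    by rewrite mulmxDl !scaler_nat !mulr2n -opprD.
  by apply: scalerI; rewrite pnatr_eq0.
move: E0; rewrite mulmxBl Ea opprK => E0.
by rewrite scaler_nat mulr2n opprD addrA -E0 addrK.
Qed.

Lemma adhM u v : br u v *m N = br (u *m N) v + br u (v *m N).
Proof. by rewrite !(mul_ad lie) br_leibniz. Qed.

Lemma br_even_even u v : u *m N = 0 -> v *m N = 0 -> br u v *m N = 0.
Proof. by move=> u0 v0; rewrite adhM u0 v0 (br0l lie) (br0r lie) addr0. Qed.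

Lemma br_even_odd u v : u *m N = 0 -> v *m N *m N = v -> br u v *m N *m N = br u v.
Proof. by move=> u0 v1; rewrite adhM u0 (br0l lie) add0r adhM u0 (br0l lie) add0r v1. Qed.

(* With c = [u,v] and d = [uN,vN] one has c N^2 = 2(c+d) = d N^2, hence
   c N^4 = 4 c N^2; but N^4 = N^2. *)
Lemma br_odd_odd u v : u *m N *m N = u -> v *m N *m N = v -> br u v *m N = 0.
Proof.
move=> u1 v1; set c := br u v; set d := br (u *m N) (v *m N).
have cNN : c *m N *m N = 2 *: (c + d).
  by rewrite !adhM mulmxDl !adhM u1 v1 -/c -/d scaler_nat mulr2n addrACA [d + c]addrC.
have dNN : d *m N *m N = 2 *: (c + d).
  rewrite !adhM mulmxDl !adhM !u1 !v1 -/c -/d scaler_nat mulr2n.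
  by rewrite [d + c]addrC.
have : c *m N *m N *m N *m N = 4 *: (c *m N *m N).
  rewrite [in LHS]cNN -!scalemxAl !mulmxDl dNN cNN -scalerDl -natrD.
  by rewrite !scalerA mulrC.
rewrite euler_cubev => /eqP; rewrite -subr_eq0 -{1}[c *m N *m N]scale1r -scalerBl.
rewrite scaler_eq0 => /orP[|/eqP c0].
  by rewrite (_ : 1 - 4 = - 3) ?oppr_eq0 ?pnatr_eq0 //; ring.
by rewrite -euler_cubev c0 mul0mx.
Qed.

(** Even means degree 0 and odd means degrees 1 and -1 together; N^2 is the projection onto the odd
    part. *)
Lemma even_odd_split v :
  exists a b, [/\ v = a + b, a *m N = 0 & b *m N *m N = b].
Proof.
exists (v - v *m N *m N), (v *m N *m N); split; first by rewrite subrK.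
  by rewrite mulmxBl euler_cubev subrr.
by rewrite euler_cubev.
Qed.

Lemma mul_tau_h v : v *m T = v - 2 *: (v *m N *m N).
Proof. by rewrite tau_hE mulmxBr mulmx1 -scalemxAr mulmxA. Qed.

Lemma tau_h_even v : v *m N = 0 -> v *m T = v.
Proof. by move=> e; rewrite mul_tau_h e mul0mx scaler0 subr0. Qed.
Lemma tau_h_odd v : v *m N *m N = v -> v *m T = - v.
Proof.
by move=> e; rewrite mul_tau_h e scaler_nat mulr2n opprD addrA subrr add0r.
Qed.

Lemma tau_h_sq : T *m T = 1%:M.
Proof.
apply/row_matrixP => i; rewrite !rowE mulmxA mulmx1; move: (delta_mx 0 i) => v.
have [a [b [-> a0 b1]]] := even_odd_split v.
rewrite !mulmxDl (tau_h_even a0) (tau_h_even a0) (tau_h_odd b1) mulNmx.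
by rewrite (tau_h_odd b1) opprK.
Qed.

Lemma tau_h_hom : lie_hom br T.
Proof.
move=> u v; have [a [b [-> a0 b1]]] := even_odd_split u.
have [c [d [-> c0 d1]]] := even_odd_split v.
rewrite !mulmxDl !(tau_h_even a0, tau_h_even c0, tau_h_odd b1, tau_h_odd d1).
rewrite !(brDl lie) !(brDr lie) !(brNl lie) !(brNr lie) opprK !mulmxDl.
rewrite (tau_h_even (br_even_even a0 c0)) (tau_h_odd (br_even_odd a0 d1)).
rewrite (tau_h_even (br_odd_odd b1 d1)) (brC lie b c) mulNmx.
by rewrite (tau_h_odd (br_even_odd c0 b1)).
Qed.

(* [y, -] has only components of degree -1, 0, 1, hence none from degree 1 to degree -1. *)
Lemma odd_block y v : br y (v *m N *m N) *m N = br y (v *m N) *m N *m N.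
Proof.
have [a [b [-> a0 b1]]] := even_odd_split y.
rewrite !(brDl lie) !mulmxDl (br_odd_odd b1) ?euler_cubev //.
rewrite (br_odd_odd b1) ?euler_cubev // mul0mx !addr0.
by rewrite (br_even_odd a0) ?euler_cubev // adhM a0 (br0l lie) add0r euler_cubev.
Qed.

End EulerGrading.

(** * Control of group elements by kappa(h, gh) *)

Section ConeGroup.
Variables (R : realType) (n : nat) (br : 'rV[R]_n -> 'rV[R]_n -> 'rV[R]_n).
Variables (h : 'rV[R]_n) (Th T : 'M[R]_n).
Hypothesis lie : is_lie_bracket br.
Hypothesis red : reductive br.
Hypothesis eul : euler br h.
Hypothesis cartan : cartan_involution br Th.
Hypothesis hTh : h *m Th = - h.
Hypothesis center_Th : forall z, in_center br z -> z *m Th = - z.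
Hypothesis tauT : is_tau_h br h T.
Implicit Types (x y z u v w : 'rV[R]_n) (g X : 'M[R]_n).

Local Notation N := (ad br h).
Local Notation K := (gram br Th).
Local Notation ip := (inner K).
Local Notation Tau := (Th *m T).
Local Notation hh := (fixed Tau).
Local Notation q := (antifixed Tau).

Let Ksym : K^T = K := gram_sym lie cartan.
Let Kpos u : u != 0 -> 0 < ip u u := @gram_pos R n br lie red Th cartan center_Th u.
Let homTh := hom_Th cartan.
Let ThTh := Th_sq cartan.
Let TT := tau_h_sq eul tauT.
Let homT := tau_h_hom lie eul tauT.

Let ip_ad x u v : ip (br x u) v = - ip u (br (x *m Th) v).
Proof. exact: gram_ad. Qed.

Let ipN u v : ip (u *m N) v = ip u (v *m N).
Proof. by rewrite !(mul_ad lie) ip_ad hTh (brNl lie) ipNr opprK. Qed.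

Let N3 v : v *m N *m N *m N = v *m N.
Proof. exact: euler_cubev. Qed.

Let ipNN v : ip (v *m N *m N) (v *m N *m N) = ip (v *m N) (v *m N).
Proof. by rewrite [LHS]ipN N3 [LHS]ipN. Qed.

Let hN : h *m N = 0.
Proof. by rewrite (mul_ad lie) brxx. Qed.

Lemma N_Th : N *m Th = - (Th *m N).
Proof.
apply/row_matrixP => i; rewrite !rowE mulmxN !mulmxA !(mul_ad lie).
by rewrite -homTh hTh brNl.
Qed.

Lemma T_Th : T *m Th = Th *m T.
Proof.
rewrite (tau_hE eul tauT) mulmxBl mulmxBr mul1mx mulmx1 -scalemxAl -scalemxAr.
by rewrite -mulmxA N_Th mulmxN mulmxA N_Th mulNmx opprK mulmxA.
Qed.

Let Tau_sq : Tau *m Tau = 1%:M.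
Proof. by rewrite mulmxA -(mulmxA Th) T_Th mulmxA ThTh mul1mx TT. Qed.

Let homTau : lie_hom br Tau.
Proof. exact: lie_homM. Qed.

Lemma tau_involution : lie_involution br Tau.
Proof.
split=> //; split; last exact: homTau.
by case: (mulmx1_unit Tau_sq).
Qed.

Let ipT u v : ip (u *m T) v = ip u (v *m T).
Proof.
by rewrite !(mul_tau_h eul tauT) ipDl ipDr ipNl ipNr ipZl ipZr !ipN.
Qed.

Let hq : q h.
Proof.
by rewrite /antifixed /= mulmxA hTh mulNmx (tau_h_even eul tauT hN).
Qed.

Let hhTh x : hh x -> x *m Th = x *m T.
Proof. by rewrite /fixed /= => e; rewrite -[x in RHS]e -!mulmxA TT mulmx1. Qed.
Let qTh x : q x -> x *m Th = - (x *m T).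
Proof.
by rewrite /antifixed /= => e; rewrite -mulNmx -e -!mulmxA TT mulmx1.
Qed.

Let NT v : v *m N *m T = - (v *m N).
Proof. by rewrite (tau_h_odd eul tauT) // N3. Qed.
Let TN v : v *m T *m N = - (v *m N).
Proof.
rewrite (mul_tau_h eul tauT) mulmxBl -scalemxAl N3 scaler_nat mulr2n opprD addrA.
by rewrite subrr add0r.
Qed.

(** Only the degree 0 part y_0 of [y] contributes, because an odd element carries odd vectors to
    even ones, which the last [N] kills. So on the odd part this is ad y_0 followed by [N]. For y in
    q one has theta y_0 = -y_0, so these are commuting symmetric operators. *)
Definition cone_op y : 'M[R]_n := N *m N *m ad br y *m N.

Lemma mul_cone_op u y : u *m cone_op y = br y (u *m N *m N) *m N.
Proof. by rewrite /cone_op !mulmxA (mul_ad lie _ y). Qed.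

Lemma cone_op_selfadj y : q y -> selfadj K (cone_op y).
Proof.
move=> qy; apply/selfadjP => u v; rewrite !mul_cone_op ipN ip_ad (qTh qy).
have E : br (y *m T) (v *m N) = - (br y (v *m N) *m T).
  by rewrite -homT NT (brNr lie) opprK.
by rewrite (brNl lie) E !ipNr !opprK ipN ipN TN mulNmx ipNr opprK (odd_block lie eul).
Qed.

(* Both sets contain Inn(h); unlike Inn(h) they are closed by construction. *)
Definition isometric_aut g :=
  [/\ lie_hom br g, (forall u v, ip (u *m g) (v *m g *m T) = ip u (v *m T)) &
      g *m Tau = Tau *m g].

Definition cone_group g := isometric_aut g /\ psd K (cone_op (h *m g)).

Lemma isometric_aut1 : isometric_aut 1%:M.
Proof. by split; [exact: lie_hom1|move=> u v; rewrite !mulmx1|rewrite mulmx1 mul1mx]. Qed.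

Lemma isometric_autM g g' :
  isometric_aut g -> isometric_aut g' -> isometric_aut (g *m g').
Proof.
move=> [H1 H2 H3] [H1' H2' H3']; split; first exact: lie_homM.
  by move=> u v; rewrite !mulmxA H2' H2.
by rewrite -mulmxA H3' [in LHS](mulmxA g) H3 -mulmxA.
Qed.

(** The preserved form <u, tau_h v> is nondegenerate, so [g] is injective. *)
Lemma isometric_aut_unit g : isometric_aut g -> g \in unitmx.
Proof.
move=> [_ H _]; rewrite -row_free_unit; apply: inj_row_free => u u0.
apply: (ip_eq0 Kpos); have := H u (u *m T).
by rewrite u0 ip0l -[u *m T *m T]mulmxA TT mulmx1.
Qed.

(** For w in h, theta w = tau_h w, so moving ad w across the form gives -<u, [tau_h w, tau_h v]> =
    -<u, tau_h [w, v]>: ad w is skew for it. Exponentiation turns skewness into invariance, and tau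
    w = w into commutation with [Tau]. *)
Lemma isometric_aut_exp w t : hh w -> isometric_aut (expmx (t *: ad br w)).
Proof.
move=> hw; split.
- apply: expmx_aut => // u v; rewrite !(mul_ad lie); exact: br_leibniz.
- have H : ad br w *m (K *m T^T) = - (K *m T^T *m (ad br w)^T).
    have sk u v : ip (br w u) (v *m T) = - ip u (br w v *m T).
      by rewrite ip_ad (hhTh hw) homT.
    apply/matrixP => i j; rewrite [RHS]mxE !gram_entry /inner.
    have := sk (delta_mx 0 i) (delta_mx 0 j); rewrite /inner -!(mul_ad lie).
    by rewrite !trmx_mul !mulmxA => ->.
  move=> u v; have := congr1 (mulmx u) (expmx_form t H); rewrite !mulmxA => E.
  by rewrite /inner !trmx_mul !mulmxA E.
- apply: expmx_commute; apply/row_matrixP => i.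
  rewrite !rowE [LHS]mulmxA [RHS]mulmxA !(mul_ad lie _ w) -homTau.
  by have -> : w *m Tau = w by exact: hw.
Qed.

Lemma antifixed_mul g x : isometric_aut g -> q x -> q (x *m g).
Proof. by move=> [_ _ H]; rewrite /antifixed /= -!mulmxA H !mulmxA => ->; rewrite mulNmx. Qed.

Let ip_even_part v : ip (v - v *m N *m N) v = ip v v - ip (v *m N) (v *m N).
Proof. by rewrite ipDl ipNl [ip (_ *m N *m N) _]ipN. Qed.

Let even_part v : (v - v *m N *m N) *m N = 0.
Proof. by rewrite mulmxBl N3 subrr. Qed.

Let ip_even_sq v : ip (v - v *m N *m N) (v - v *m N *m N) = ip (v - v *m N *m N) v.
Proof. by rewrite [LHS]ipDr ipNr -[ip _ (_ *m N)]ipN even_part ip0l subr0. Qed.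

Let ip_even_ge0 v : 0 <= ip (v - v *m N *m N) v.
Proof. by rewrite -ip_even_sq; exact: ip_ge0. Qed.

Let ip_odd_le v : ip (v *m N) (v *m N) <= ip v v.
Proof. by rewrite -subr_ge0 -ip_even_part; exact: ip_even_ge0. Qed.

Let ip_tau v : ip v (v *m T) = ip v v - 2 * ip (v *m N) (v *m N).
Proof.
by rewrite (mul_tau_h eul tauT) ipDr ipNr ipZr -[ip v (_ *m N *m N)]ipN.
Qed.

(* With w = u g^-1 and Y = ad (hg) one has wN = (uY) g^-1. The form
   ip v (vT) = |v|^2 - 2 |vN|^2 is g-invariant: on (w, u) it gives
   |w|^2 = 2 |wN|^2 - |u|^2, and on (wN, uY) it gives |wN|^2 <= |uYN|^2. *)
Lemma odd_vector_bounds g u : isometric_aut g -> u *m N *m N = u ->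
  ip u u <= ip (u *m cone_op (h *m g)) (u *m cone_op (h *m g)) /\
  ip (u *m invmx g) (u *m invmx g) <=
    2 * ip (u *m cone_op (h *m g)) (u *m cone_op (h *m g)).
Proof.
move=> ig uodd; have ug := isometric_aut_unit ig.
case: ig => [Hg1 Hg2 _].
set w := u *m invmx g; have uE : u = w *m g by rewrite /w mulmxKV.
have -> : u *m cone_op (h *m g) = w *m N *m g *m N.
  rewrite mul_cone_op uodd -(mul_ad lie) uE -(mulmxA w) ad_hom //.
  by rewrite !mulmxA.
have E1 := Hg2 w w; have E2 := Hg2 (w *m N) (w *m N).
move: E1; rewrite -uE (tau_h_odd eul tauT uodd) ipNr ip_tau => E1.
move: E2; rewrite !ip_tau ipNN => E2.
have L1 := ip_odd_le (w *m N *m g); have L2 := ip_odd_le w.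
have L3 := ip_ge0 Kpos u; by split; lra.
Qed.

(** [cone_op] vanishes on the even part, which would spoil the lower bound |uS| >= |u| of
    [psd_path]. Adding the projection onto the even part restores it: the two summands act on
    orthogonal pieces, and positivity is unaffected. *)
Let shifted y : 'M[R]_n := cone_op y + (1%:M - N *m N).

Let mul_shifted y u : u *m shifted y = u *m cone_op y + (u - u *m N *m N).
Proof. by rewrite mulmxDr mulmxBr mulmx1 [u *m (N *m N)]mulmxA. Qed.

Let cone_op_odd y u : u *m N *m N *m cone_op y = u *m cone_op y.
Proof. by rewrite !mul_cone_op N3. Qed.

Let shifted_selfadj y : q y -> selfadj K (shifted y).
Proof.
move=> qy; apply/selfadjP => u v; rewrite !mul_shifted !ipDl !ipDr !ipNl !ipNr.
have sa := proj1 (selfadjP _ _) (cone_op_selfadj qy).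
by rewrite sa; congr (_ + (_ - _)); rewrite !ipN.
Qed.

Let shifted_lower g u : isometric_aut g ->
  ip u u <= ip (u *m shifted (h *m g)) (u *m shifted (h *m g)).
Proof.
move=> ig; rewrite mul_shifted -[u *m cone_op _]cone_op_odd.
have [H _] := @odd_vector_bounds g (u *m N *m N) ig (N3 _ ).
set a := _ *m cone_op _ in H *.
have aE : a = a *m N *m N by rewrite /a mul_cone_op N3.
have ortho : ip a (u - u *m N *m N) = 0.
  by rewrite aE 2!ipN even_part mul0mx ip0r.
rewrite ipDl !(ipDr _ a) ortho (ipC Ksym _ a) ortho addr0 add0r.
have E := ip_even_part u; rewrite ipNN in H.
rewrite ip_even_sq E; lra.
Qed.

Let shifted_psd y : psd K (shifted y) <-> psd K (cone_op y).
Proof.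
split=> H u.
  have := H (u *m N *m N); rewrite mul_shifted cone_op_odd N3 subrr addr0.
  by rewrite -ipN -ipN mul_cone_op N3.
by rewrite mul_shifted ipDl addr_ge0.
Qed.

Lemma cone_group_path (F : R -> 'M[R]_n) :
  mxcts F -> (forall t, isometric_aut (F t)) -> cone_group (F 0) -> cone_group (F 1).
Proof.
move=> cF iF [_ F0]; split=> //; apply/shifted_psd.
apply: (psd_path Ksym Kpos (S := fun t => shifted (h *m F t))).
- apply: mxctsD; last exact: mxcts_const.
  apply: mxctsM; last exact: mxcts_const.
  apply: mxctsM; first exact: mxcts_const.
  apply: mxcts_ad => //; apply: mxctsM => //; exact: mxcts_const.
- by move=> t; apply: shifted_selfadj; apply: antifixed_mul.
- by move=> t u; apply: shifted_lower.
- exact/shifted_psd.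
Qed.

Lemma cone_group1 : cone_group 1%:M.
Proof.
split; first exact: isometric_aut1.
move=> u; rewrite mulmx1 mul_cone_op -(mul_ad lie) N3 -[u *m N *m N]/(_ *m _) ipN.
exact: ip_ge0.
Qed.

(** Matrices act on the right, so this factor acts before [g]; this is the stability behind the
    invariance of the cone. *)
Lemma cone_group_expl w g : hh w -> cone_group g -> cone_group (expmx (ad br w) *m g).
Proof.
move=> hw Zg.
have := @cone_group_path (fun t => expmx (t *: ad br w) *m g).
rewrite scale1r expmx0 mul1mx; apply=> //.
  by apply: mxctsM; [exact: mxcts_expmx|exact: mxcts_const].
by move=> t; apply: isometric_autM; [exact: isometric_aut_exp|case: Zg].
Qed.

(** Here the exponential acts after [g]; this allows a minimizer on an orbit to be varied. *)
Lemma cone_group_expr w g : hh w -> cone_group g -> cone_group (g *m expmx (ad br w)).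
Proof.
move=> hw Zg.
have := @cone_group_path (fun t => g *m expmx (t *: ad br w)).
rewrite scale1r expmx0 mulmx1; apply=> //.
  by apply: mxctsM; [exact: mxcts_const|exact: mxcts_expmx].
by move=> t; apply: isometric_autM; [case: Zg|exact: isometric_aut_exp].
Qed.

Lemma trace_cone_op y : \tr (cone_op y) = killing br h y.
Proof. by rewrite mxtrace_mulC !mulmxA (euler_cube eul). Qed.

Lemma cone_group_bound g : cone_group g ->
  1 <= killing br h (h *m g) /\
  forall v, ip (v *m g) (v *m g) <= 9 * killing br h (h *m g) ^+ 2 * ip v v.
Proof.
move=> [ig pg]; rewrite -trace_cone_op; set s := \tr _.
have ug := isometric_aut_unit ig; have [_ Hg2 _] := ig.
have sa : selfadj K (cone_op (h *m g)).
  by apply: cone_op_selfadj; exact: antifixed_mul.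
have [s0 trP] := psd_trace Ksym Kpos sa pg; rewrite -/s in s0 trP.
have sq u : ip (u *m cone_op (h *m g)) (u *m cone_op (h *m g)) <= s ^+ 2 * ip u u.
  have [H1 H2] := trP u; apply: (le_trans H1).
  by rewrite expr2 -mulrA ler_wpM2l.
(* As N is not 0 there is an odd u other than 0, and it satisfies |u| <= |uM| <= s|u|. *)
have s1 : 1 <= s.
  have /rowV0Pn[_ /submxP[c ->] u0] : N != 0 by case: eul.
  have [H1 _] := odd_vector_bounds ig (N3 c).
  have H2 := le_trans H1 (sq _); have := Kpos u0 => H3.
  rewrite -(@ler_pXn2r _ 2) ?nnegrE // expr1n.
  by rewrite -(ler_pM2r H3) mul1r.
split=> // v; set o := ip (v *m g *m N) (v *m g *m N).
have o0 : 0 <= o by exact: ip_ge0.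
have v0 : 0 <= ip v v by exact: ip_ge0.
have oE u : ip (u *m T) (u *m T) = ip u u by rewrite ipT -mulmxA TT mulmx1.
(* Put a = vgN^2, so |a|^2 = o. Invariance of the form gives <a g^-1, tau_h v> = -o, and
   Cauchy-Schwarz gives o^2 <= |a g^-1|^2 |v|^2 <= 2 s^2 o |v|^2. *)
have ole : o <= 2 * s ^+ 2 * ip v v.
  have [_ H1] := odd_vector_bounds ig (N3 (v *m g *m N)).
  have H2 := sq (v *m g *m N *m N).
  have H3 := ip_cauchy Ksym Kpos (v *m g *m N *m N *m invmx g) (v *m T).
  have E : ip (v *m g *m N *m N *m invmx g) (v *m T) = - o.
    by rewrite -Hg2 mulmxKV // -ipT NT ipNl ipN.
  have oo : ip (v *m g *m N *m N) (v *m g *m N *m N) = o by exact: ipNN.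
  rewrite E sqrrN oE in H3; rewrite oo in H2.
  have [->|on] := eqVneq o 0; first by rewrite !mulr_ge0 // exprn_ge0.
  have op : 0 < o by rewrite lt_neqAle eq_sym on.
  rewrite -(ler_pM2r op) -expr2; apply: (le_trans H3).
  rewrite mulrAC ler_wpM2r //; apply: (le_trans H1).
  by rewrite -mulrA ler_wpM2l.
(* Invariance on (v, v) reads |vg|^2 - 2o = |v|^2 - 2|vN|^2, so |vg|^2 <= |v|^2 + 2o <= 5 s^2 |v|^2;
   the constant 9 is generous. *)
have := Hg2 v v; rewrite !ip_tau -/o => E.
have L := ip_ge0 Kpos (v *m N).
have s2 : ip v v <= s ^+ 2 * ip v v.
  by rewrite ler_peMl // -(expr1n R 2) ler_pXn2r ?nnegrE.
rewrite -mulrA in ole; rewrite -mulrA; lra.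
Qed.

End ConeGroup.

(** * The invariant cone and minima on orbits *)

Section InvariantCone.
Variables (R : realType) (n : nat) (br : 'rV[R]_n -> 'rV[R]_n -> 'rV[R]_n).
Variables (h : 'rV[R]_n) (Th T : 'M[R]_n).
Hypothesis lie : is_lie_bracket br.
Hypothesis red : reductive br.
Hypothesis eul : euler br h.
Hypothesis cartan : cartan_involution br Th.
Hypothesis hTh : h *m Th = - h.
Hypothesis center_Th : forall z, in_center br z -> z *m Th = - z.
Hypothesis tauT : is_tau_h br h T.
Implicit Types (x y z u v w : 'rV[R]_n) (g X : 'M[R]_n).

Local Notation N := (ad br h).
Local Notation K := (gram br Th).
Local Notation ip := (inner K).
Local Notation Tau := (Th *m T).
Local Notation hh := (fixed Tau).
Local Notation q := (antifixed Tau).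
Local Notation cone_group := (cone_group br h Th T).
Local Notation isometric_aut := (isometric_aut br Th T).

Let Ksym : K^T = K := gram_sym lie cartan.
Let Kpos u : u != 0 -> 0 < ip u u := @gram_pos R n br lie red Th cartan center_Th u.

Let hq : q h.
Proof.
rewrite /antifixed /= mulmxA hTh mulNmx (tau_h_even eul tauT) //.
by rewrite (mul_ad lie) brxx.
Qed.

Lemma cone_group_norm : exists2 B, 0 < B &
  forall g v, cone_group g -> `|v *m g| <= B * killing br h (h *m g) * `|v|.
Proof.
have [c c0 cP] := ip_lower Kpos.
pose C := \sum_i \sum_j `|K i j|.
have C0 : 0 <= C by rewrite sumr_ge0 // => i _; rewrite sumr_ge0.
have CP v : ip v v <= C * `|v| ^+ 2.
  by apply: le_trans (ler_norm _) _; exact: form_le.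
have B0 : 0 < 9 * C / c + 1 by rewrite ltr_wpDl // divr_ge0 ?mulr_ge0 // ltW.
(* The added 1 makes this B at least 1, so B^2 >= B >= 9C/c and no square root is taken. *)
exists (9 * C / c + 1) => // g v Zg.
have [s1 sP] := cone_group_bound lie red eul cartan hTh center_Th tauT Zg.
set s := killing br h (h *m g) in s1 sP *.
have s0 : 0 <= s by apply: le_trans s1.
rewrite -(@ler_pXn2r _ 2) ?nnegrE ?mulr_ge0 // ?(ltW B0) //.
have H1 : c * `|v *m g| ^+ 2 <= 9 * s ^+ 2 * (C * `|v| ^+ 2).
  apply: (le_trans (cP _)); apply: (le_trans (sP v)).
  by rewrite ler_wpM2l // mulr_ge0 // exprn_ge0.
apply: (@le_trans _ _ ((9 * C / c) * (s ^+ 2 * `|v| ^+ 2))).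
  rewrite -(ler_pM2l c0); apply: (le_trans H1).
  by rewrite le_eqVlt; apply/orP; left; apply/eqP; field; rewrite gt_eqF.
rewrite !exprMn -[leRHS]mulrA ler_wpM2r ?mulr_ge0 ?exprn_ge0 //.
apply: (@le_trans _ _ (9 * C / c + 1)); first by rewrite lerDl.
by rewrite expr2 ler_peMl ?(ltW B0) // lerDr divr_ge0 ?mulr_ge0 // ltW.
Qed.

Lemma killing_norm : exists2 L, 0 < L & forall v, `|killing br h v| <= L * `|v|.
Proof.
have [a aE] : exists a, a = h *m killing_mx br by eexists.
have a0 : 0 <= \sum_j `|a 0 j| by rewrite sumr_ge0.
exists (1 + \sum_j `|a 0 j|) => [|v]; first by rewrite ltr_wpDr.
rewrite (killingE lie) -aE mxE; apply: le_trans (ler_norm_sum _ _ _) _.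
apply: (@le_trans _ _ ((\sum_j `|a 0 j|) * `|v|)).
  rewrite mulr_suml; apply: ler_sum => j _; rewrite normrM mxE ler_wpM2l //.
  rewrite [leRHS]/Num.Def.normr /= mx_normrE.
  exact: (le_bigmax _ _ (0, j)).
by rewrite ler_wpM2r // lerDr.
Qed.

Lemma killingD x y : killing br h (x + y) = killing br h x + killing br h y.
Proof. by rewrite !(killingE lie) linearD mulmxDr mxE. Qed.
Lemma killingN x : killing br h (- x) = - killing br h x.
Proof. by rewrite !(killingE lie) linearN mulmxN mxE. Qed.

Definition inv_cone (d : R) : set 'rV[R]_n :=
  [set x | q x /\ forall g, cone_group g -> d * `|x *m g| <= killing br h (x *m g)].

(** Every error term is proportional to s = kappa(h, hg), which is why one radius serves all g. The
    choice of [r] makes |kappa(h, ug)| <= L B s r = s/2, leaving kappa(h, (h+u)g) >= s/2; as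
    |(h+u)g| <= B s (|h| + r), the choice of [d] keeps d|(h+u)g| below s/2. *)
Lemma inv_cone_ball : exists d r : R, [/\ 0 < d, 0 < r &
  forall u, q u -> `|u| <= r -> inv_cone d (h + u)].
Proof.
have [B B0 BP] := cone_group_norm; have [L L0 LP] := killing_norm.
pose r := (2 * L * B)^-1.
have r0 : 0 < r by rewrite invr_gt0 !mulr_gt0.
have hr0 : 0 < `|h| + r by rewrite ltr_wpDl.
exists (2 * B * (`|h| + r))^-1, r; split => // [|u qu ur].
  by rewrite invr_gt0 !mulr_gt0.
split.
  by rewrite /antifixed /= mulmxDl opprD; congr (_ + _); [exact: hq|exact: qu].
move=> g Zg; have [s1 _] := cone_group_bound lie red eul cartan hTh center_Th tauT Zg.
have := BP _ u Zg; have := BP _ (h + u) Zg; have := LP (u *m g).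
rewrite [in killing br h ((h + u) *m g)]mulmxDl killingD.
move: s1; set s := killing br h (h *m g) => s1; set t := killing br h (u *m g).
move=> H1 H2 H3.
have s0 : 0 < s by exact: lt_le_trans s1.
have K1 : `|t| <= s / 2.
  apply: (le_trans H1); apply: (@le_trans _ _ (L * (B * s * r))).
    rewrite ler_wpM2l ?(ltW L0) //; apply: (le_trans H3).
    by rewrite ler_wpM2l // mulr_ge0 // ltW.
  rewrite le_eqVlt; apply/orP; left; apply/eqP; rewrite /r; field.
  by rewrite !gt_eqF.
have K2 : `|(h + u) *m g| <= B * s * (`|h| + r).
  apply: (le_trans H2); rewrite ler_wpM2l ?mulr_ge0 ?(ltW B0) ?(ltW s0) //.
  by apply: (le_trans (ler_normD _ _)); rewrite lerD2l.
have K3 : (2 * B * (`|h| + r))^-1 * `|(h + u) *m g| <= s / 2.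
  rewrite mulrC ler_pdivrMr ?mulr_gt0 //; apply: (le_trans K2).
  by rewrite le_eqVlt; apply/orP; left; apply/eqP; field.
apply: (le_trans K3); move: K1; rewrite ler_norml => /andP[K1 _]; lra.
Qed.

Lemma cone_group_inn g g' : inn_group br hh g -> cone_group g' -> cone_group (g *m g').
Proof.
move=> Gg Zg'; elim: Gg => [|x g1 hx _ IH]; first by rewrite mul1mx.
by rewrite -mulmxA; apply: cone_group_expl.
Qed.

Lemma inv_cone_good (d r : R) : 0 < d -> 0 < r ->
  (forall u, q u -> `|u| <= r -> inv_cone d (h + u)) ->
  good_cone br hh q (inv_cone d).
Proof.
move=> d0 r0 ball.
have Z1 : cone_group 1%:M by exact: cone_group1.
have coneZ (a : R) x : 0 <= a -> inv_cone d x -> inv_cone d (a *: x).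
  move=> a0 [qx Hx]; split.
    by rewrite /antifixed /= -scalemxAl qx scalerN.
  move=> g Zg; rewrite -scalemxAl killingZr // normrZ ger0_norm // mulrCA.
  by rewrite ler_wpM2l // Hx.
have qZ (a : R) x : q x -> q (a *: x).
  by rewrite /antifixed /= -scalemxAl => ->; rewrite scalerN.
split; split => //.
- by move=> x [].
- split; first by rewrite /antifixed /= mul0mx oppr0.
  by move=> g _; rewrite mul0mx normr0 mulr0 (killingE lie) trmx0 mulmx0 mxE.
- move=> x y [qx Hx] [qy Hy]; split.
    by rewrite /antifixed /= mulmxDl qx qy opprD.
  move=> g Zg; rewrite mulmxDl killingD.
  apply: (@le_trans _ _ (d * (`|x *m g| + `|y *m g|))).
    by rewrite ler_wpM2l ?ler_normD // ltW.
  by rewrite mulrDr lerD // ?Hx ?Hy.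
- have ctsM p (g : 'M[R]_(n, p)) : mxcts (fun x : 'rV[R]_n => x *m g).
    by apply: mxctsM; [exact: mxcts_id|exact: mxcts_const].
  have -> : inv_cone d = [set x | x *m Tau = x *m - 1%:M] `&`
     \bigcap_(g in cone_group)
       [set x | 0 <= (x *m (g *m (h *m killing_mx br)^T)) 0 0 - d * `|x *m g|].
    have kE x g : (x *m (g *m (h *m killing_mx br)^T)) 0 0 = killing br h (x *m g).
      rewrite killingE // -[in LHS](trmxK (x *m _)) mxE; congr (_ 0 0).
      by rewrite !trmx_mul trmxK !trmxK mulmxA.
    apply/seteqP; split => x.
      move=> [qx Hx]; split; first by rewrite /= mulmxN mulmx1; exact: qx.
      by move=> g Zg /=; rewrite kE subr_ge0 Hx.
    move=> [qx Hx]; split; first by move: qx; rewrite /= mulmxN mulmx1.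
    by move=> g Zg; have := Hx g Zg; rewrite /= kE subr_ge0.
  apply: closedI; first exact: closed_mxeq.
  apply: closed_bigI => g _.
  apply: (@closed_comp _ _ (fun x : 'rV[R]_n =>
    (x *m (g *m (h *m killing_mx br)^T)) 0 0 - d * `|x *m g|) [set y | 0 <= y]).
    2: exact: closed_ge.
  move=> x _; have ng : continuous (fun y : 'rV[R]_n => y *m g) by exact: continuous_mx.
  have nng : {for x, continuous (fun y : 'rV[R]_n => `|y *m g|)}.
    apply: (@continuous_comp _ _ _ (fun y : 'rV[R]_n => y *m g) (fun z => `|z|)).
      exact: ng.
    exact: norm_continuous.
  have dng : {for x, continuous (fun y : 'rV[R]_n => d * `|y *m g|)}.
    by apply: continuousM nng; exact: cst_continuous.
  exact: continuousB (@ctsM _ (g *m (h *m killing_mx br)^T) 0 0 x) dng.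
- move=> x [_ Hx] [_ Hx'].
  have := Hx _ Z1; have := Hx' _ Z1; rewrite !mulmx1 killingN normrN => H1 H2.
  apply/eqP; rewrite -normr_le0 -(pmulr_rle0 _ d0); lra.
(* With |tz| <= r both h + tz and h lie in the cone, and z is t^-1 times their difference. *)
- move=> z qz; pose t := r / (`|z| + 1).
  have z1 : 0 < `|z| + 1 by rewrite ltr_wpDl.
  have t0 : 0 < t by rewrite divr_gt0.
  exists (t^-1 *: (h + t *: z)), (t^-1 *: h); split.
  + apply: coneZ; first by rewrite invr_ge0 ltW.
    apply: ball; first exact: qZ.
    rewrite normrZ gtr0_norm // /t mulrAC ler_pdivrMr // ler_pM2l //.
    by rewrite lerDl.
  + apply: coneZ; first by rewrite invr_ge0 ltW.
    rewrite -[h]addr0; apply: ball; last by rewrite normr0 ltW.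
    by rewrite /antifixed /= mul0mx oppr0.
  + by rewrite scalerDr scalerA mulVf ?gt_eqF // scale1r addrC addKr.
- move=> g x Gg [qx Hx]; split.
    by have [ig _] := cone_group_inn Gg Z1; rewrite mulmx1 in ig; exact: (antifixed_mul ig qx).
  by move=> g' Zg'; rewrite -mulmxA; apply: Hx; exact: cone_group_inn.
Qed.

Lemma inv_cone_interior (d r : R) : 0 < r ->
  (forall u, q u -> `|u| <= r -> inv_cone d (h + u)) ->
  rel_interior q (inv_cone d) h.
Proof.
move=> r0 ball; split.
  rewrite -[h]addr0; apply: ball; last by rewrite normr0 ltW.
  by rewrite /antifixed /= mul0mx oppr0.
apply/nbhs_ballP; exists r => // y; rewrite -ball_normE /= => hy qy.
have -> : y = h + (y - h) by rewrite addrC subrK.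
apply: ball; last by rewrite distrC ltW.
by rewrite /antifixed /= mulmxBl qy hq opprB opprK addrC.
Qed.

(** All conditions are equations or weak inequalities between continuous functions of [g].
    Invertibility, an open condition, is a consequence and not part of the definition. *)
Lemma closed_cone_group (S : topologicalType) (F : S -> 'M[R]_n) :
  mxcts F -> closed [set t | cone_group (F t)].
Proof.
move=> cF.
have cmul m p (A : 'M[R]_(m, n)) (B : 'M[R]_(n, p)) : mxcts (fun t => A *m F t *m B).
  apply: mxctsM; last exact: mxcts_const.
  by apply: mxctsM => //; exact: mxcts_const.
have cmull m (A : 'M[R]_(m, n)) : mxcts (fun t => A *m F t).
  by apply: mxctsM => //; exact: mxcts_const.
have -> : [set t | cone_group (F t)] =
   (\bigcap_(uv in [set: 'rV[R]_n * 'rV[R]_n])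
      [set t | uv.2 *m F t *m ad br (uv.1 *m F t) = br uv.1 uv.2 *m F t]) `&`
   (\bigcap_(uv in [set: 'rV[R]_n * 'rV[R]_n])
      [set t | uv.1 *m F t *m K *m (uv.2 *m F t *m T)^T = uv.1 *m K *m (uv.2 *m T)^T]) `&`
   [set t | F t *m Tau = Tau *m F t] `&`
   (\bigcap_(u in [set: 'rV[R]_n])
      [set t | 0 <= (u *m cone_op br h (h *m F t) *m K *m u^T) 0 0]).
  apply/seteqP; split => t.
    move=> [[H1 H2 H3] H4]; split; [split; [split|exact: H3]|].
    - by move=> [u v] _ /=; rewrite (mul_ad lie) H1.
    - move=> [u v] _ /=; apply/matrixP => i j; rewrite !ord1; exact: H2.
    - by move=> u _; exact: H4.
  move=> [[[H1 H2] H3] H4]; split; [split => //|].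
  - by move=> u v; have := H1 (u, v) I; rewrite /= (mul_ad lie).
  - by move=> u v; have := H2 (u, v) I; rewrite /= /inner => ->.
  - by move=> u; exact: H4 u I.
apply: closedI; [apply: closedI; [apply: closedI|]|].
- apply: closed_bigI => -[u v] _ /=; apply: closed_mxeq => //.
  by apply: mxctsM => //; apply: mxcts_ad.
- apply: closed_bigI => -[u v] _ /=; apply: closed_mxeq; last exact: mxcts_const.
  exact: ip_mxcts.
- apply: closed_mxeq; first by apply: mxctsM => //; exact: mxcts_const.
  exact: cmull.
- apply: closed_bigI => u _; apply: closed_mxge0; apply: ip_mxcts; last exact: mxcts_const.
  apply: mxctsM; first exact: mxcts_const.
  apply: mxctsM; last exact: mxcts_const.
  apply: mxctsM; first exact: mxcts_const.
  by apply: mxcts_ad.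
Qed.

(** Where kappa(h, xg) is at most its value m at g = 1, kappa(h, hg) <= m/eta, and [cone_group_norm]
    bounds g. The sublevel set is closed, hence compact. *)
Lemma orbit_minimum x (eta : R) : 0 < eta ->
  (forall g, cone_group g -> eta * killing br h (h *m g) <= killing br h (x *m g)) ->
  exists2 g, cone_group g &
    forall g', cone_group g' -> killing br h (x *m g) <= killing br h (x *m g').
Proof.
move=> eta0 low; have [B B0 BP] := cone_group_norm.
have Z1 : cone_group 1%:M by exact: cone_group1.
have cvec : mxcts (fun v : 'rV[R]_(n * n) => vec_mx v).
  move=> i j; rewrite (_ : (fun _ => _) = (fun v : 'rV[R]_(n * n) => v 0 (mxvec_index i j))).
    exact: coord_continuous.
  by apply/funext => v; rewrite mxE.
pose F (v : 'rV[R]_(n * n)) : R := (h *m killing_mx br *m (x *m vec_mx v)^T) 0 0.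
have FE (v : 'rV[R]_(n * n)) : F v = killing br h (x *m vec_mx v) by rewrite (killingE lie).
have cF : continuous F.
  suff /(_ 0 0) : mxcts (fun v : 'rV[R]_(n * n) =>
      h *m killing_mx br *m (x *m vec_mx v)^T) by [].
  apply: mxctsM; first exact: mxcts_const.
  by apply: mxcts_tr; apply: mxctsM => //; exact: mxcts_const.
pose m := killing br h (x *m 1%:M).
pose A := [set v : 'rV[R]_(n * n) | cone_group (vec_mx v) /\ F v <= m].
have [] := @EVT_min_rV R _ F A.
- by exists (mxvec 1%:M); rewrite /A /= FE mxvecK.
- apply: bounded_closed_compact.
    (* Each entry of g is a coordinate of some e_i g, and the sum dominates every |e_i|. *)
    exists (B * (m / eta) * (1 + \sum_i `|delta_mx 0 i : 'rV[R]_n|)).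
    split; first by rewrite num_real.
    move=> r mr v [Zv Fv]; apply: le_trans (ltW mr).
    have [s1 _] := cone_group_bound lie red eul cartan hTh center_Th tauT Zv.
    have sm : killing br h (h *m vec_mx v) <= m / eta.
      by rewrite ler_pdivlMr // mulrC; apply: le_trans Fv; rewrite FE; exact: low.
    have me0 : 0 <= m / eta by apply: le_trans sm; apply: le_trans s1.
    have S0 : 0 <= \sum_i `|delta_mx 0 i : 'rV[R]_n| by rewrite sumr_ge0.
    rewrite [leLHS]/Num.Def.normr /= mx_normrE; apply: bigmax_le.
      apply: mulr_ge0; last exact: addr_ge0.
      by apply: mulr_ge0 => //; exact: ltW.
    move=> [a k] _; rewrite ord1 /=; case/mxvec_indexP: k => i j.
    have -> : v 0 (mxvec_index i j) = ((delta_mx 0 i : 'rV[R]_n) *m vec_mx v) 0 j.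
      by rewrite -rowE !mxE.
    apply: (@le_trans _ _ `|(delta_mx 0 i : 'rV[R]_n) *m vec_mx v|).
      rewrite [leRHS]/Num.Def.normr /= mx_normrE; exact: (le_bigmax _ _ (0, j)).
    apply: (le_trans (BP _ _ Zv)).
    apply: ler_pM => //; first by rewrite mulr_ge0 ?(ltW B0) // (le_trans _ s1).
      by rewrite ler_wpM2l // ltW.
    by rewrite (bigD1 i) //= addrCA lerDl addr_ge0 // sumr_ge0.
  apply: (@closedI _ [set v | cone_group (vec_mx v)] (F @^-1` [set y | y <= m])).
    exact: closed_cone_group.
  apply: closed_comp; last exact: closed_le.
  by move=> v _; exact: cF.
- exact: continuous_subspaceT.
move=> v /set_mem [Zv Fv] vmin; exists (vec_mx v) => // g' Zg'.
rewrite -FE; have [gm|/ltW mg] := leP (killing br h (x *m g')) m.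
  have := vmin (mxvec g'); rewrite [F (mxvec _)]FE mxvecK; apply; apply: mem_set.
  by rewrite /A /= FE mxvecK.
exact: le_trans Fv mg.
Qed.

(** Differentiating at 0 gives kappa(h, [w, z]) = 0 for all w in h. Since h and z lie in q, [h, z]
    lies in the fixed algebra, and so does w = theta [h, z]. This w yields kappa([h, z], theta
    [h, z]) = 0, and definiteness on [g, g] forces [h, z] = 0. *)
Lemma orbit_critical z : q z ->
  (forall w, hh w -> killing br h z <= killing br h (z *m expmx (ad br w))) ->
  z *m N = 0.
Proof.
move=> qz zmin.
have crit w : hh w -> killing br h (br w z) = 0.
  move=> hw.
  pose f (t : R) := killing br h (z *m expmx (t *: ad br w)).
  have df (t : R) : is_derive t (1 : R) f (killing br h (z *m (ad br w *m expmx (t *: ad br w)))).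
    have H1 := mxderM (mxder_const z t) (mxder_expmx (ad br w) t).
    have := mxderM (mxder_const (h *m killing_mx br) t) (mxder_tr H1).
    rewrite !mul0mx !add0r => /(_ 0 0).
    rewrite -(killingE lie) (_ : (fun _ => _) = f) //.
    by apply/funext => t'; rewrite /f (killingE lie).
  have f0 : is_derive (0 : R) (1 : R) f 0.
    apply: (@derive1_at_min R f (-1) 1 0).
    - lra.
    - by move=> t _; case: (df t).
    - by rewrite in_itv /=; apply/andP; split; lra.
    - move=> t _; rewrite /f expmx0 mulmx1 -adZ //; apply: zmin.
      by rewrite /fixed /= -scalemxAl hw.
  have := df 0; rewrite expmx0 mulmx1 (mul_ad lie) => d0.
  by have := @derive_val _ _ _ _ _ _ _ d0; rewrite (@derive_val _ _ _ _ _ _ _ f0).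
apply/eqP/negPn/negP => zN0.
have zNh : hh (z *m N).
  rewrite /fixed /= [in LHS](mul_ad lie) -(lie_homM (hom_Th cartan) (tau_h_hom lie eul tauT)).
  have -> : h *m Tau = - h by exact: hq.
  have -> : z *m Tau = - z by exact: qz.
  by rewrite (brNl lie) (brNr lie) opprK (mul_ad lie).
have TauTh : Tau *m Th = Th *m Tau by rewrite -mulmxA (T_Th lie eul cartan hTh tauT).
have zNTh : hh (z *m N *m Th).
  by rewrite /fixed /= -[LHS]mulmxA -TauTh [LHS]mulmxA zNh.
case: cartan => _ /(_ (z *m N)); move=> /(_ _ zN0).
have zNd : in_derived br (z *m N).
  by apply: (derived_mxP lie); rewrite (mul_ad lie); exact: br_derived.
move=> /(_ zNd).
have := crit _ zNTh.
rewrite (brC lie) killingN -(killing_br lie) -(mul_ad lie z h) => /eqP.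
by rewrite oppr_eq0 => /eqP ->; rewrite oppr0 ltxx.
Qed.

(** Interiority is used once: x - eta h stays in the cone, so kappa(h, xg) >= eta kappa(h, hg), the
    coercivity required by [orbit_minimum]. The factor 2(|h| + 1) in [eta] makes |eta h| < e, also
    if the norm of h is small. *)
Lemma inv_cone_ncc (d : R) x : 0 < d ->
  rel_interior q (inv_cone d) x -> diagonalizable_R (ad br x).
Proof.
move=> d0 [[qx Hx] /nbhs_ballP[e /= e0 eP]].
pose eta := e / (2 * (`|h| + 1)).
have h1 : 0 < `|h| + 1 by rewrite ltr_wpDl.
have eta0 : 0 < eta by rewrite divr_gt0 // mulr_gt0.
have [_ Heta] : inv_cone d (x - eta *: h).
  apply: eP; last first.
    by rewrite /antifixed /= mulmxBl qx -scalemxAl hq scalerN -opprD.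
  rewrite -ball_normE /= opprB addrC subrK normrZ gtr0_norm // /eta mulrAC.
  rewrite ltr_pdivrMr ?mulr_gt0 // ltr_pM2l //.
  have := normr_ge0 h; lra.
have [g Zg gmin] : exists2 g, cone_group g &
    forall g', cone_group g' -> killing br h (x *m g) <= killing br h (x *m g').
  apply: (orbit_minimum eta0) => g Zg.
  have := Heta g Zg; rewrite mulmxBl killingD killingN -scalemxAl killingZr //.
  have : 0 <= d * `|x *m g - eta *: (h *m g)| by rewrite mulr_ge0 // ltW.
  lra.
have ig : isometric_aut g by case: Zg.
have qz : q (x *m g) by exact: (antifixed_mul ig qx).
have zN : x *m g *m N = 0.
  apply: orbit_critical => // w hw; rewrite -mulmxA; apply: gmin.
  exact: cone_group_expr.
have zTh : x *m g *m Th = - (x *m g).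
  rewrite -(tau_h_even eul tauT zN) -[in LHS]mulmxA (T_Th lie eul cartan hTh tauT).
  by rewrite qz (tau_h_even eul tauT zN).
have sa : selfadj K (ad br (x *m g)).
  apply/selfadjP => u v; rewrite !(mul_ad lie) gram_ad // zTh (brNl lie) ipNr.
  by rewrite opprK.
have [P [D [uP PD _]]] := selfadj_diagonalizable Ksym Kpos sa.
have ug := isometric_aut_unit lie red eul cartan center_Th tauT ig.
(* ad x and ad (xg) are conjugate by the automorphism g, so an eigenbasis is carried back by
   g^-1. *)
exists (P *m invmx g), D; split => //; first by rewrite unitmx_mul uP unitmx_inv.
have [Hg _ _] := ig; move: PD; rewrite (ad_aut lie x Hg ug) => PD.
apply: (can_inj (mulmxK ug)); rewrite -!mulmxA mulVmx // mulmx1 -PD.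
by rewrite !mulmxA.
Qed.

(** For x in [I], [h, x] is fixed by tau, yet tau [h, x] = [-h, x]; so [h, x] = 0, whence tau_h x =
    x and theta x = x. Then ad x is skew for [gram], which is the required invariant inner
    product. *)
Lemma tau_fixed_ideal_compact I : is_ideal br I ->
  (forall x, (x <= I)%MS -> hh x) -> compact_ideal br I.
Proof.
move=> idI fixI.
have I_Th x : (x <= I)%MS -> x *m Th = x.
  move=> xI; have fx : x *m Tau = x by exact: fixI.
  have xN : x *m N = 0.
    have := fixI _ (idI h x xI); rewrite /fixed /=.
    rewrite -(lie_homM (hom_Th cartan) (tau_h_hom lie eul tauT)) fx.
    have -> : h *m Tau = - h by exact: hq.
    rewrite (brNl lie) (mul_ad lie) => /eqP; rewrite eq_sym -addr_eq0 -mulr2n.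
    by rewrite -scaler_nat scaler_eq0 pnatr_eq0 => /eqP.
  rewrite -[in RHS]fx -(T_Th lie eul cartan hTh tauT) mulmxA.
  by rewrite (tau_h_even eul tauT xN).
exists K; split.
- by move=> u v _ _; exact: ipC.
- by move=> u _; exact: Kpos.
- move=> x y z xI _ _.
  by have := gram_ad lie cartan x y z; rewrite I_Th.
Qed.

End InvariantCone.

Unset Implicit Arguments.

Theorem theorem4p2 (R : realType) (n : nat) (br : 'rV[R]_n -> 'rV[R]_n -> 'rV[R]_n)
  (h : 'rV[R]_n) (Th T : 'M[R]_n) :
  is_lie_bracket br -> reductive br ->
  euler br h ->
  cartan_involution br Th ->
  h *m Th = - h ->
  (forall z, in_center br z -> z *m Th = - z) ->
  is_tau_h br h T ->
  let Tau := Th *m T in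
  [/\ lie_involution br Tau,
      ncc br Tau,
      (exists C, good_cone br (fixed Tau) (antifixed Tau) C /\
                 rel_interior (antifixed Tau) C h) &
      (forall I, is_ideal br I -> (forall x, (x <= I)%MS -> fixed Tau x) ->
                 compact_ideal br I)].
Proof.
move=> lie red eul cartan hTh center_Th tauT Tau.
have [d [r [d0 r0 ball]]] := inv_cone_ball lie red eul cartan hTh center_Th tauT.
have good := inv_cone_good lie red eul cartan hTh center_Th tauT d0 r0 ball.
split.
- exact: (tau_involution lie eul cartan hTh tauT).
- exists (inv_cone br h Th T d); split=> // x.
  exact: (inv_cone_ncc lie red eul cartan hTh center_Th tauT).
- exists (inv_cone br h Th T d); split=> //.
  exact: (inv_cone_interior lie eul hTh tauT r0 ball).
- exact: (tau_fixed_ideal_compact lie red eul cartan hTh center_Th tauT).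
Qed.
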